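(* Let $\mathfrak g$ be an affine Lie algebra with weight lattice $P$ and Weyl group $W$. For any $\lambda\in P$, the weight of any vector $b\in B(\lambda)$ is contained in the convex hull of $W\lambda$, where $B(\lambda)$ is the crystal base of the extremal weight module $V(\lambda)$ over $U_q(\mathfrak g)$.
   Context: Setup. $\mathfrak g$ is an affine Kac–Moody Lie algebra with Cartan subalgebra $\mathfrak t$ over $\mathbb Q$ of dimension $|I|+1$, linearly independent simple roots $\alpha_i\in\mathfrak t^*$ and simple coroots $h_i\in\mathfrak t$ ($i\in I$), $Q=\bigoplus_i\mathbb Z\alpha_i$. $\delta=\sum_i a_i\alpha_i$ is the generator with nonnegative coefficients of $\{\lambda\in Q:\langle h_i,\lambda\rangle=0\ \forall i\}$, and $c=\sum_i a_i^\vee h_i$ the generator with nonnegative coefficients of $\{h\in\bigoplus_i\mathbb Zh_i:\langle h,\alpha_i\rangle=0\ \forall i\}$. $(\cdot,\cdot)$ is the nondegenerate $W$-invariant symmetric form on $\mathfrak t^*$ with $(\delta,\lambda)=\langle c,\lambda\rangle$. $P\subset\mathfrak t^*$ is a lattice with $\alpha_i\in P$, $h_i\in P^*$, and such that for each $i$ there is $\Lambda_i\in P$ with $\langle h_j,\Lambda_i\rangle=\delta_{ij}$. Quantum group. Fix $d\in\mathbb Z_{>0}$ with $(\alpha_i,\alpha_i)/2\in d^{-1}\mathbb Z$ for all $i$; $q_s=q^{1/d}$, $K=\mathbb Q(q_s)$. $U_q(\mathfrak g)$ is the $K$-algebra generated by $e_i,f_i$ $(i\in I)$ and $q^h$ ($h\in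 d^{-1}P^*$) with the usual relations, where $q_i=q^{(\alpha_i,\alpha_i)/2}$, $t_i=q^{\frac{(\alpha_i,\alpha_i)}2h_i}$, $[e_i,f_j]=\delta_{ij}(t_i-t_i^{-1})/(q_i-q_i^{-1})$; $e_i^{(n)}=e_i^n/[n]_i!$, $f_i^{(n)}=f_i^n/[n]_i!$. Integrable modules have a weight decomposition with weights in $P$ and locally nilpotent $e_i,f_i$. Extremal vectors. A weight vector $u$ of weight $\lambda\in P$ in an integrable module is extremal if there are vectors $\{u_w\}_{w\in W}$ with $u_e=u$ and, for all $w,i$: if $\langle h_i,w\lambda\rangle\ge0$ then $e_iu_w=0$ and $f_i^{(\langle h_i,w\lambda\rangle)}u_w=u_{s_iw}$; if $\langle h_i,w\lambda\rangle\le0$ then $f_iu_w=0$ and $e_i^{(-\langle h_i,w\lambda\rangle)}u_w=u_{s_iw}$. $V(\lambda)$ is the $U_q(\mathfrak g)$-module generated by $u_\lambda$ with the defining relations that $u_\lambda$ is an extremal vector of weight $\lambda$; by earlier work of Kashiwara it is integrable and has a crystal base $(L(\lambda),B(\lambda))$ (at $q_s=0$) and a global basis. *)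

(* Defs.v *)
From mathcomp Require Import all_boot all_order all_algebra.
From mathcomp Require Import sesquilinear boolp classical_sets.

Set Implicit Arguments.
Unset Strict Implicit.
Unset Printing Implicit Defensive.
Import Order.TTheory GRing.Theory Num.Theory.
Local Open Scope ring_scope.
Local Open Scope classical_set_scope.

(* Convex hull in a vector space over rat. *)
Definition convex_hull (E : lmodType rat) (X : set E) : set E :=
  [set x | exists (s : seq E) (c : E -> rat),
     [/\ (forall y, y \in s -> X y /\ 0 <= c y),
         \sum_(y <- s) c y = 1 &
         x = \sum_(y <- s) c y *: y]].

(* ** Affine Cartan data *)

(* The dual of t; the pairing <h, lambda> is the application lambda h. *)
Notation dual t := 'Hom(t, rat^o).

Definition is_lattice (E : vectType rat) (P : set E) : Prop :=
  exists2 b : (\dim {:E}).-tuple E,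
    basis_of {:E} b & forall x, P x <-> inIntSpan b x.

(* Generalized Cartan matrices of affine type: indecomposable, with kernel *)
(* the line spanned by a positive vector.                                   *)
Record affine_GCM (I : finType) (A : I -> I -> rat) : Prop := AffineGCM {
  gcm_diag : forall i, A i i = 2;
  gcm_offdiag : forall i j, i != j -> exists n : nat, A i j = - n%:R;
  gcm_zero : forall i j, A i j = 0 -> A j i = 0;
  gcm_indecomposable : forall J : {set I},
    (forall i j, i \in J -> j \notin J -> A i j = 0) ->
    J = finset.set0 \/ J = [set: I]%SET;
  gcm_affine : exists u : I -> rat,
    [/\ (forall i, 0 < u i),
        (forall i, \sum_j A i j * u j = 0) &
        forall v : I -> rat, (forall i, \sum_j A i j * v j = 0) ->
          exists r : rat, forall i, v i = r * u i]
}.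

(* s_i lambda = lambda - <h_i, lambda> alpha_i *)
Definition reflection (t : vectType rat) (h : t) (a : dual t) : 'End(dual t) :=
  linfun (fun x : dual t => x - (x h : rat) *: a).

Record affine_datum := AffineDatum {
  idx : finType;
  cartan : vectType rat;
  alpha : idx -> dual cartan;
  coroot : idx -> cartan;
  wlattice : set (dual cartan);
  delta_coef : idx -> nat;
  c_coef : idx -> nat;
  tform : {symmetric (dual cartan)};
  dd : nat;
  cartan_dim : \dim {: cartan} = #|idx|.+1;
  root_free : free [seq alpha i | i : idx];
  coroot_free : free [seq coroot i | i : idx];
  cartan_affine : affine_GCM (fun i j => alpha j (coroot i) : rat);
  (* delta and c generate the respective kernels, and have nonnegative *)
  (* coefficients.                                                       *)
  delta_gen : forall m : idx -> int,
    (forall i, (\sum_j alpha j *~ m j) (coroot i) = 0) <->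
    exists k : int, forall i, m i = k * (delta_coef i)%:Z;
  c_gen : forall m : idx -> int,
    (forall j, alpha j (\sum_i coroot i *~ m i) = 0) <->
    exists k : int, forall i, m i = k * (c_coef i)%:Z;
  form_nondegenerate :
    forall x, (forall y, tform x y = 0) -> x = 0;
  form_invariant : forall i x y,
    tform (reflection (coroot i) (alpha i) x) (reflection (coroot i) (alpha i) y)
    = tform x y;
  form_delta : forall x : dual cartan,
    tform (\sum_i alpha i *+ delta_coef i) x
    = x (\sum_i coroot i *+ c_coef i);
  wlattice_lattice : is_lattice wlattice;
  root_wlattice : forall i, wlattice (alpha i);
  coroot_wlattice : forall i x, wlattice x -> (x (coroot i) : rat) \is a Num.int;
  fund_wlattice : forall i, exists2 x, wlattice x &
    forall j, x (coroot j) = (i == j)%:R;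
  dd_gt0 : (0 < dd)%N;
  dd_form : forall i, dd%:R * (tform (alpha i) (alpha i) / 2) \is a Num.int
}.

Section Datum.
Variable D : affine_datum.
Local Notation I := (idx D).
Local Notation t := (cartan D).
Local Notation td := (dual (cartan D)).
Local Notation P := (@wlattice D).

Definition srefl (i : I) : 'End(td) := reflection (coroot i) (alpha i).

(* The Weyl group, as a submonoid (hence subgroup, the reflections being *)
(* involutions) of linear endomorphisms of the dual of t.                 *)
Inductive weyl : set 'End(td) :=
| weyl_id : weyl \1%VF
| weyl_refl i w : weyl w -> weyl (srefl i \o w)%VF.

Definition weyl_orbit (lambda : td) : set td :=
  [set (w : 'End(td)) lambda | w in weyl].

(* d^-1 P^* *)
Definition coweight (h : t) : Prop :=
  forall x : td, P x -> (x ((dd D)%:R *: h) : rat) \is a Num.int.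

(* ** The quantum group and its modules *)

(* K = Q(q_s) *)
Definition K : fieldType := {fraction {poly rat}}.
Definition qs : K := tofrac ('X : {poly rat}).

(* q^r = q_s^(d r); only meaningful for d r an integer. *)
Definition qpow (r : rat) : K := qs ^ Num.floor ((dd D)%:R * r).

Definition hnorm (i : I) : rat := tform D (alpha i) (alpha i) / 2.
Definition qi (i : I) : K := qpow (hnorm i).
Definition ti (i : I) : t := hnorm i *: coroot i.

Definition qint (i : I) (n : nat) : K :=
  (qi i ^+ n - qi i ^- n) / (qi i - (qi i)^-1).
Definition qfact (i : I) (n : nat) : K := \prod_(1 <= k < n.+1) qint i k.
Definition dpow (V : lmodType K) (i : I) (x : V -> V) (n : nat) (v : V) : V :=
  (qfact i n)^-1 *: iter n x v.

(* A U_q(g)-module: a K-vector space with operators e_i, f_i and q^h, for h *)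
(* in d^-1 P^*, subject to the defining relations of U_q(g).  The operators *)
(* uq_q h for h outside d^-1 P^* are irrelevant.                            *)
Record uqModule := UqModule {
  uq_sort :> lmodType K;
  uq_e : I -> {linear uq_sort -> uq_sort};
  uq_f : I -> {linear uq_sort -> uq_sort};
  uq_q : t -> {linear uq_sort -> uq_sort};
  uq_q0 : forall v, uq_q 0 v = v;
  uq_qD : forall h h' v, coweight h -> coweight h' ->
    uq_q (h + h') v = uq_q h (uq_q h' v);
  uq_qe : forall h i v, coweight h ->
    uq_q h (uq_e i (uq_q (- h) v)) = qpow (alpha i h) *: uq_e i v;
  uq_qf : forall h i v, coweight h ->
    uq_q h (uq_f i (uq_q (- h) v)) = qpow (- (alpha i h : rat)) *: uq_f i v;
  uq_ef : forall i j v,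
    uq_e i (uq_f j v) - uq_f j (uq_e i v) =
    if i == j then
      (qi i - (qi i)^-1)^-1 *: (uq_q (ti i) v - uq_q (- ti i) v)
    else 0;
  (* quantum Serre relations, with n = - <h_i, alpha_j> *)
  uq_serre_e : forall i j (n : nat) v, i != j ->
    alpha j (coroot i) = - n%:R ->
    \sum_(k < n.+2) (-1) ^+ k *:
      dpow i (uq_e i) k (uq_e j (dpow i (uq_e i) (n.+1 - k) v)) = 0;
  uq_serre_f : forall i j (n : nat) v, i != j ->
    alpha j (coroot i) = - n%:R ->
    \sum_(k < n.+2) (-1) ^+ k *:
      dpow i (uq_f i) k (uq_f j (dpow i (uq_f i) (n.+1 - k) v)) = 0
}.

#[global] Arguments uq_e {u} i.
#[global] Arguments uq_f {u} i.
#[global] Arguments uq_q {u} h.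

Record uq_hom (M N : uqModule) (phi : {linear M -> N}) : Prop := UqHom {
  hom_e : forall i v, phi (uq_e i v) = uq_e i (phi v);
  hom_f : forall i v, phi (uq_f i v) = uq_f i (phi v);
  hom_q : forall h v, coweight h -> phi (uq_q h v) = uq_q h (phi v)
}.

Record uq_submodule (M : uqModule) (S : set M) : Prop := UqSubmodule {
  sub_0 : S 0;
  sub_D : forall v w, S v -> S w -> S (v + w);
  sub_Z : forall a v, S v -> S (a *: v);
  sub_e : forall i v, S v -> S (uq_e i v);
  sub_f : forall i v, S v -> S (uq_f i v);
  sub_q : forall h v, coweight h -> S v -> S (uq_q h v)
}.

(* The weight space M_lambda, lambda in P. *)
Definition wspace (M : uqModule) (lambda : td) : set M :=
  [set v | P lambda /\
     forall h, coweight h -> uq_q h v = qpow (lambda h) *: v].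

(* ** Extremal weight modules *)

(* The family u_w only matters for w in the Weyl group.  If u is extremal, *)
(* e_i and f_i are locally nilpotent on the submodule it generates, so      *)
(* integrability of M is not imposed separately.                            *)
Definition extremal (M : uqModule) (lambda : td) (u : M) : Prop :=
  wspace lambda u /\
  exists uw : 'End(td) -> M,
    uw \1%VF = u /\
    forall w i (n : nat), weyl w ->
      (w lambda (coroot i) = n%:R ->
         uq_e i (uw w) = 0 /\
         dpow i (uq_f i) n (uw w) = uw (srefl i \o w)%VF) /\
      (w lambda (coroot i) = - n%:R ->
         uq_f i (uw w) = 0 /\
         dpow i (uq_e i) n (uw w) = uw (srefl i \o w)%VF).

(* (V, u) is the module V(lambda) presented by the generator u and the *)
(* relations expressing that u is extremal of weight lambda.             *)
Record extremal_weight_module (lambda : td) (V : uqModule) (u : V) : Prop :=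
  ExtremalWeightModule {
    ewm_extremal : extremal lambda u;
    ewm_generated : forall S : set V, uq_submodule S -> S u -> forall v, S v;
    ewm_universal : forall (M : uqModule) (m : M), extremal lambda m ->
      exists2 phi : {linear V -> M}, uq_hom phi & phi u = m
  }.

(* ** Crystal bases *)

(* A: the rational functions in q_s that are regular at q_s = 0. *)
Definition regular0 : set K :=
  [set x | exists p r : {poly rat}, r.[0] != 0 /\ x = tofrac p / tofrac r].

Section Crystal.
Variable M : uqModule.

(* v = \sum_k f_i^(n_k) x_k with x_k in M_mu, e_i x_k = 0 and                *)
(* 0 <= n_k <= <h_i, mu>, for some mu (depending on k).                      *)
Definition string_decomp (i : I) (v : M) (s : seq (nat * M)) : Prop :=
  v = \sum_(p <- s) dpow i (uq_f i) p.1 p.2 /\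
  forall p, p \in s ->
    uq_e i p.2 = 0 /\
    exists mu : td, wspace mu p.2 /\ (p.1%:R : rat) <= mu (coroot i).

(* Graphs of the modified root operators; on an integrable module these are *)
(* everywhere defined and single valued.                                     *)
Definition ftilde (i : I) (v w : M) : Prop :=
  exists2 s, string_decomp i v s &
    w = \sum_(p <- s) dpow i (uq_f i) p.1.+1 p.2.
Definition etilde (i : I) (v w : M) : Prop :=
  exists2 s, string_decomp i v s &
    w = \sum_(p <- s | (0 < p.1)%N) dpow i (uq_f i) p.1.-1 p.2.

Record crystal_lattice (L : set M) : Prop := CrystalLattice {
  lat_0 : L 0;
  lat_D : forall v w, L v -> L w -> L (v + w);
  lat_Z : forall a v, regular0 a -> L v -> L (a *: v);
  (* L has an A-basis S *)
  lat_free : exists S : set M,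
    (forall v, L v <-> exists (s : seq M) (a : M -> K),
       [/\ uniq s, (forall x, x \in s -> S x /\ regular0 (a x)) &
           v = \sum_(x <- s) a x *: x]) /\
    (forall (s : seq M) (a : M -> K),
       uniq s -> (forall x, x \in s -> S x /\ regular0 (a x)) ->
       \sum_(x <- s) a x *: x = 0 -> forall x, x \in s -> a x = 0);
  (* the multiplication map from the tensor product of K and L over A to M *)
  (* is onto; it is injective because K is a localization of A              *)
  lat_gen : forall v, exists (s : seq M) (a : M -> K),
    (forall x, x \in s -> L x) /\ v = \sum_(x <- s) a x *: x;
  (* L is the sum (necessarily direct) of its weight spaces *)
  lat_weight : forall v, L v -> exists s : seq M,
    (forall x, x \in s -> L x /\ exists mu, wspace mu x) /\
    v = \sum_(x <- s) x;
  lat_f : forall i v w, L v -> ftilde i v w -> L w;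
  lat_e : forall i v w, L v -> etilde i v w -> L w
}.

(* Equality in L / q_s L. *)
Definition cong0 (L : set M) (v w : M) : Prop :=
  exists2 y, L y & v - w = qs *: y.

(* The class of v in L / q_s L belongs to L_mu / q_s L_mu. *)
Definition has_weight (L : set M) (v : M) (mu : td) : Prop :=
  exists x, [/\ L x, wspace mu x & cong0 L v x].

(* A subset of L / q_s L is encoded by its preimage B in L; an element b of *)
(* the crystal is thus the class of any v in B.                              *)
Record crystal_base (L B : set M) : Prop := CrystalBase {
  cb_lattice : crystal_lattice L;
  cb_sub : B `<=` L;
  cb_cong : forall v w, B v -> L w -> cong0 L v w -> B w;
  (* B is a basis over the rationals of L / q_s L *)
  cb_free : forall (s : seq M) (a : M -> rat),
    (forall x, x \in s -> B x) ->
    uniq s -> (forall x y, x \in s -> y \in s -> cong0 L x y -> x = y) ->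
    cong0 L (\sum_(x <- s) (ratr (a x) : K) *: x) 0 ->
    forall x, x \in s -> a x = 0;
  cb_span : forall v, L v -> exists (s : seq M) (a : M -> rat),
    (forall x, x \in s -> B x) /\
    cong0 L v (\sum_(x <- s) (ratr (a x) : K) *: x);
  cb_weight : forall v, B v -> exists mu, has_weight L v mu;
  cb_f : forall i v w, B v -> ftilde i v w -> B w \/ cong0 L w 0;
  cb_e : forall i v w, B v -> etilde i v w -> B w \/ cong0 L w 0;
  cb_ef : forall i v w, B v -> B w ->
    (exists2 x, ftilde i v x & cong0 L x w) <->
    (exists2 x, etilde i w x & cong0 L x v)
}.

End Crystal.
End Datum.

(* Main.v *)
From HB Require Import structures.
Require Import Defs.
From mathcomp Require Import all_boot all_order all_algebra.
From mathcomp Require Import sesquilinear boolp classical_sets.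
From mathcomp Require Import ring lra zify.
Import Order.TTheory GRing.Theory Num.Theory.
Local Open Scope ring_scope.
Set Implicit Arguments.
Unset Strict Implicit.
Unset Printing Implicit Defensive.

(** A crystal element is nonzero modulo q_s L, so the weights of B are weights of
    V, and it suffices to place every weight of V in the convex hull of the orbit
    W lambda. V is generated by the extremal vector u; write u_w for the vectors
    attached to it, with u_1 = u.

    The engine is a remark on the Demazure modules U^+ u_w. If
    <h_i, w lambda> >= 0, then f_i kills u_(s_i w) and u_w is a divided power of
    e_i applied to u_(s_i w). Hence U^+ u_(s_i w) is stable under f_i and
    contains U^+ u_w ([up_f], [up_incl]); since e_i and f_i are locally
    nilpotent ([nilp_ee], [nilp_ef]), its weights are stable under s_i
    ([iter_f_inj], [up_weight_sym]).

    At negative level some w lambda is antidominant ([pos_level_ind]), so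
    U^+ u_w is stable under every f_i and equals V, and an induction on height
    finishes ([negative_level_hull]). Positive level reduces to this by
    exchanging e and f ([twist]).

    At level zero V is the line K u if every <h_i, lambda> vanishes. Otherwise
    let phi be a level-zero functional whose maximum on W lambda is attained at
    w lambda. For a weight mu of U^+ u_w put xi = mu - w lambda, a nonnegative
    combination of simple roots. Then (rho - r phi, xi) >= 0 for all r >= 0:
    this is clear while rho - r phi is dominant, and where the line leaves the
    dominant chamber through a wall i, maximality of phi gives
    <h_i, w lambda> >= 0, so that the remark replaces w by s_i w and reflects
    the line back. Letting r grow gives (phi, mu) <= (phi, w lambda)
    ([walk_bound], [demazure_bound]). To pass from one U^+ u_w to V, walk
    through chambers by steps w -> s_i w with <h_i, w phi> > 0: the U^+ u_w
    increase, every i remains available ([reach_fair]), so their sum is V; and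
    as w phi takes finitely many values modulo delta, the walk can be taken
    recurrent ([reach_recurrent]), which transports the bound to phi itself
    ([weight_bound]). A point outside the hull of W lambda would be separated
    from it by such a phi ([orbit_separation], a consequence of [farkas]). *)

(** * Strings for quantum sl2 *)

Section Strings.
Variables (F : fieldType) (q : F).
Hypothesis q_free : forall n : nat, (0 < n)%N -> q ^+ n != 1.
Hypothesis q_neq0 : q != 0.

Definition qnum (n : int) : F := (q ^ n - q ^ (- n)) / (q - q^-1).

Lemma q_sub_neq0 : q - q^-1 != 0.
Proof.
have := @q_free 2 isT; apply: contraNneq => /eqP.
by rewrite subr_eq0 => /eqP eq_q; rewrite expr2 {1}eq_q mulVf.
Qed.

Lemma qnum_opp n : qnum (- n) = - qnum n.
Proof. by rewrite /qnum opprK -mulNr opprB. Qed.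

Lemma qnum1 : qnum 1 = 1.
Proof. by rewrite /qnum expr1z exprN1 divff // q_sub_neq0. Qed.

Lemma qnum_neq0 (n : nat) : (0 < n)%N -> qnum n != 0.
Proof.
move=> n_gt0; rewrite /qnum mulf_neq0 ?invr_eq0 ?q_sub_neq0 // subr_eq0.
have := @q_free (n + n) ltac:(lia); apply: contraNneq => eq_q.
by rewrite exprD {1}(_ : q ^+ n = q ^ n) // eq_q -exprnN mulVf // expf_neq0.
Qed.

(** The sum [n] + [n - 2] + ... telescopes to a product; this is the
    inductive step. *)
Lemma qnum_step (n : int) (m : nat) :
  qnum m.+1 * qnum (n - m%:Z) + qnum (n - (2 * m.+1)%N%:Z)
  = qnum m.+2 * qnum (n - m.+1%:Z).
Proof.
have qm0 : q ^ m != 0 by rewrite expfz_neq0.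
have qn0 : q ^ n != 0 by rewrite expfz_neq0.
have Em1 : q ^ m.+1%:Z = q ^ m * q by rewrite intS addrC expfzDr // expr1z.
have Em2 : q ^ m.+2%:Z = q ^ m * q * q.
  by rewrite intS addrC expfzDr // expr1z Em1.
have En (k : int) : q ^ (n - k) = q ^ n / q ^ k.
  by rewrite expfzDr // invr_expz.
have En' (k : int) : q ^ (- (n - k)) = q ^ k / q ^ n.
  by rewrite opprB expfzDr // invr_expz.
have E2 : q ^ (2 * m.+1)%N%:Z = (q ^ m * q) ^+ 2.
  by rewrite -Em1 expr2 -expfzDr // mul2n -addnn PoszD.
have EN (k : int) : q ^ (- k) = (q ^ k)^-1 by rewrite invr_expz.
rewrite /qnum !En !En' !EN E2 Em1 Em2.
have := q_sub_neq0; move: qm0 qn0; set a := q ^ m; set b := q ^ n => a0 b0.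
have -> : q - q^-1 = (q ^+ 2 - 1) / q by field.
rewrite mulf_eq0 invr_eq0 (negPf q_neq0) orbF => q21.
by field; apply/and4P.
Qed.

Variables (M : lmodType F) (e f : {linear M -> M}) (G : int -> M -> Prop).
Hypothesis G_e : forall n v, G n v -> G (n + 2) (e v).
Hypothesis G_f : forall n v, G n v -> G (n - 2) (f v).
Hypothesis G_comm : forall n v, G n v -> e (f v) - f (e v) = qnum n *: v.

Lemma G_iter_f n m v : G n v -> G (n - (2 * m)%N%:Z) (iter m f v).
Proof.
move=> Gv; elim: m => [|m IH] /=; first by rewrite muln0 subr0.
by have := G_f IH; congr (G _ _); lia.
Qed.

Lemma e_iter_f n m v : G n v ->
  e (iter m.+1 f v)
  = iter m.+1 f (e v) + (qnum m.+1 * qnum (n - m%:Z)) *: iter m f v.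
Proof.
move=> Gv; elim: m => [|m IH].
  by have /eqP := G_comm Gv; rewrite subr_eq addrC qnum1 mul1r subr0 /= => /eqP.
have /eqP := G_comm (G_iter_f m.+1 Gv); rewrite subr_eq => /eqP /= ->.
rewrite -/(iter m.+1 f v) IH linearD linearZ /= addrC -addrA; congr (_ + _).
by rewrite -scalerDl qnum_step.
Qed.

(** Induction on the nilpotency order N. If e v = 0 then e brings f^(n) v back
    to v through nonzero multiples. In general f^n v = 0 forces
    f^(n+2) (e v) = 0 by the commutation rule, hence e v = 0. *)
Lemma iter_f_inj N : forall (n : nat) v, G n v -> iter N e v = 0 ->
  iter n f v = 0 -> v = 0.
Proof.
elim: N => [|N IH] n v Gv // eNv fnv.
have ev0 : e v = 0.
  apply: (IH n.+2).
  - by have := G_e Gv; congr (G _ _); lia.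
  - by rewrite -iterSr.
  have := @e_iter_f n n.+1 v Gv.
  by rewrite /= fnv !linear0 addr0.
have down k : (k <= n)%N -> iter k f v = 0 -> v = 0.
  elim: k => [|k IHk] // lekn fk.
  apply: IHk; first exact: ltnW.
  have := @e_iter_f n k v Gv; rewrite fk ev0 linear0 (_ : iter k.+1 f 0 = 0).
    rewrite add0r => /esym/eqP; rewrite scaler_eq0 mulf_eq0.
    rewrite (negPf (qnum_neq0 _)) // subzn ?(ltnW lekn) //.
    by rewrite (negPf (qnum_neq0 _)) ?subn_gt0 // => /eqP.
  by elim: (k.+1) => //= j ->; rewrite linear0.
exact: down fnv.
Qed.

End Strings.

(** * The invariant form and the Weyl group *)

Lemma common_denominator (T : finType) (f : T -> rat) :
  exists2 N : nat, (0 < N)%N & forall i, N%:R * f i \is a Num.int.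
Proof.
exists (\prod_i `|denq (f i)|)%N.
  by apply: prodn_gt0 => i; rewrite absz_gt0 denq_eq0.
move=> i; rewrite (bigD1 i) //= natrM mulrAC.
rewrite natr_absz ger0_norm ?denq_ge0 // mulrC.
rewrite rpredM ?natr_int // {2}[f i](esym (divq_num_den _)) mulrC divfK.
  exact: intr_int.
by rewrite intr_eq0 denq_eq0.
Qed.

Section ReflectionLinear.
Variables (t : vectType rat) (h : t) (a : dual t).

Definition reflection_fun (x : dual t) : dual t := x - (x h : rat) *: a.

Lemma reflection_fun_linear : linear reflection_fun.
Proof.
move=> c x y; rewrite /reflection_fun !lfunE /= scalerDl scalerBr scalerA.
by rewrite opprD addrACA lfunE.
Qed.

HB.instance Definition _ :=
  GRing.isLinear.Build rat (dual t) (dual t) *:%R reflection_fun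
    reflection_fun_linear.

Lemma reflectionE x : reflection h a x = x - (x h : rat) *: a.
Proof. exact: (lfunE reflection_fun x). Qed.

End ReflectionLinear.

Section Geometry.
Variable D : affine_datum.
Local Notation I := (idx D).
Local Notation t := (cartan D).
Local Notation td := (dual (cartan D)).
Local Notation P := (@wlattice D).
Local Notation W := (@weyl D).

Definition pr (i : I) (x : td) : rat := x (coroot i).

Lemma pr0 i : pr i 0 = 0. Proof. by rewrite /pr lfunE. Qed.
Lemma prD i x y : pr i (x + y) = pr i x + pr i y.
Proof. by rewrite /pr lfunE. Qed.
Lemma prN i x : pr i (- x) = - pr i x. Proof. by rewrite /pr lfunE. Qed.
Lemma prB i x y : pr i (x - y) = pr i x - pr i y.
Proof. by rewrite prD prN. Qed.
Lemma prZ i a x : pr i (a *: x) = a * pr i x. Proof. by rewrite /pr lfunE. Qed.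
Lemma pr_sum i (J : finType) (F : J -> td) :
  pr i (\sum_j F j) = \sum_j pr i (F j).
Proof. by rewrite /pr sum_lfunE. Qed.

Lemma pr_alphaii i : pr i (alpha i) = 2.
Proof. exact: (gcm_diag (cartan_affine D) i). Qed.

Lemma pr_alpha_neg i j : i != j -> exists n : nat, pr i (alpha j) = - n%:R.
Proof. exact: (gcm_offdiag (cartan_affine D)). Qed.

Lemma pr_alpha_int i j : pr i (alpha j) \is a Num.int.
Proof. exact: coroot_wlattice (root_wlattice j). Qed.

Definition form (x y : td) : rat := tform D x y.

Lemma formC x y : form x y = form y x.
Proof. by rewrite /form hermC expr0 mul1r. Qed.
Lemma formDl x y z : form (x + y) z = form x z + form y z.
Proof. by rewrite /form linearDl. Qed.
Lemma formDr x y z : form x (y + z) = form x y + form x z.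
Proof. by rewrite /form linearDr. Qed.
Lemma formZl a x y : form (a *: x) y = a * form x y.
Proof. by rewrite /form linearZl_LR. Qed.
Lemma formZr a x y : form x (a *: y) = a * form x y.
Proof. by rewrite /form linearZr_LR. Qed.
Lemma formNl x y : form (- x) y = - form x y.
Proof. by rewrite /form linearNl. Qed.
Lemma formNr x y : form x (- y) = - form x y.
Proof. by rewrite /form linearNr. Qed.
Lemma formBl x y z : form (x - y) z = form x z - form y z.
Proof. by rewrite formDl formNl. Qed.
Lemma formBr x y z : form x (y - z) = form x y - form x z.
Proof. by rewrite formDr formNr. Qed.
Lemma form0l x : form 0 x = 0.
Proof. by rewrite -(subrr x) formBl subrr. Qed.
Lemma form_suml (J : finType) (F : J -> td) y :
  form (\sum_j F j) y = \sum_j form (F j) y.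
Proof.
apply: (big_morph (fun x => form x y)); last exact: form0l.
by move=> x z; rewrite formDl.
Qed.
Lemma form_sumr (J : finType) (F : J -> td) y :
  form y (\sum_j F j) = \sum_j form y (F j).
Proof. by rewrite formC form_suml; apply: eq_bigr => j _; rewrite formC. Qed.

Lemma sreflE i x : srefl i x = x - pr i x *: alpha i.
Proof. exact: reflectionE. Qed.

Lemma pr_srefl i x : pr i (srefl i x) = - pr i x.
Proof. by rewrite sreflE prB prZ pr_alphaii; ring. Qed.

Lemma sreflK (i : I) : involutive (srefl i : td -> td).
Proof.
move=> x; rewrite [srefl i (srefl i x)]sreflE pr_srefl scaleNr opprK.
by rewrite sreflE subrK.
Qed.

Lemma srefl_comp (i : I) : (srefl i \o srefl i)%VF = \1%VF :> 'End(td).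
Proof. by apply/lfunP => x; rewrite !lfunE /= sreflK. Qed.

Lemma form_srefl i x y : form (srefl i x) (srefl i y) = form x y.
Proof. exact: form_invariant. Qed.

Lemma form_alphal i x : form (alpha i) x = hnorm i * pr i x.
Proof.
have := form_srefl i (alpha i) x; rewrite !sreflE pr_alphaii.
rewrite !(formBl, formBr, formZl, formZr) /hnorm /form; lra.
Qed.

Lemma form_alphar i x : form x (alpha i) = hnorm i * pr i x.
Proof. by rewrite formC form_alphal. Qed.

Definition delta : td := \sum_i alpha i *+ delta_coef i.
Definition level (x : td) : rat := form delta x.

Lemma levelD x y : level (x + y) = level x + level y.
Proof. exact: formDr. Qed.
Lemma levelB x y : level (x - y) = level x - level y.
Proof. exact: formBr. Qed.
Lemma levelZ a x : level (a *: x) = a * level x.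
Proof. exact: formZr. Qed.
Lemma levelN x : level (- x) = - level x.
Proof. exact: formNr. Qed.

Lemma delta_intsum : delta = \sum_i alpha i *~ (delta_coef i)%:Z.
Proof. by apply: eq_bigr => i _; rewrite pmulrn. Qed.

Lemma pr_delta i : pr i delta = 0.
Proof.
rewrite /pr delta_intsum; apply: (delta_gen (fun i => (delta_coef i)%:Z)).2.
by exists 1 => j; rewrite mul1r.
Qed.

Lemma level_c x : level x = x (\sum_i coroot i *+ c_coef i).
Proof. exact: form_delta. Qed.

Lemma level_alpha (i : I) : level (alpha i) = 0.
Proof. by rewrite /level form_alphar pr_delta mulr0. Qed.

Lemma level_srefl i x : level (srefl i x) = level x.
Proof. by rewrite sreflE levelB levelZ level_alpha mulr0 subr0. Qed.

Lemma level_sum x : level x = \sum_i (delta_coef i)%:R * hnorm i * pr i x.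
Proof.
rewrite /level form_suml; apply: eq_bigr => i _.
by rewrite -scaler_nat formZl form_alphal mulrA.
Qed.

Lemma alpha_neq0 (i : I) : alpha i != 0.
Proof.
have : alpha i \in [seq @alpha D i | i : I].
  by apply/mapP; exists i; rewrite ?mem_enum.
by apply: contraTneq => ->; apply/negP => /(free_not0 (root_free D)); rewrite eqxx.
Qed.

(** A positive vector in the kernel of the Cartan matrix, rescaled to integers,
    is a multiple of the coefficient vector of delta. *)
Lemma delta_coef_gt0 (i : I) : (0 < delta_coef i)%N.
Proof.
have [u [u_gt0 u0 _]] := gcm_affine (cartan_affine D).
have [N N_gt0 Nu] := common_denominator u.
have [|k Ek] := (delta_gen (fun i => Num.floor (N%:R * u i))).1.
  move=> j; rewrite sum_lfunE.
  transitivity (N%:R * \sum_l pr j (alpha l) * u l); last by rewrite u0 mulr0.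
  rewrite mulr_sumr; apply: eq_bigr => l _.
  rewrite -scaler_int floorK // -[LHS]/(pr j (_ *: _)) prZ.
  by rewrite mulrAC mulrA.
rewrite lt0n; apply/eqP => a0.
have : N%:R * u i = 0 by rewrite -[LHS]floorK // Ek a0 mulr0.
by apply/eqP; rewrite mulf_neq0 ?pnatr_eq0 -?lt0n ?lt0r_neq0.
Qed.

Lemma fund_exists (i : I) : exists x : td, forall j, pr j x = (i == j)%:R.
Proof. by have [x _ Hx] := fund_wlattice i; exists x. Qed.

Definition fund i : td := projT1 (cid (fund_exists i)).
Lemma pr_fund i j : pr j (fund i) = (i == j)%:R.
Proof. by rewrite /fund; case: cid. Qed.

(** Evaluating (delta, -) = c at the i-th fundamental weight gives
    a_i hnorm i = a_i^v >= 0, and the form is nondegenerate. *)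
Lemma hnorm_gt0 (i : I) : 0 < hnorm i.
Proof.
have h0 : 0 <= (delta_coef i)%:R * hnorm i.
  have := level_c (fund i); rewrite level_sum (bigD1 i) //= big1; last first.
    by move=> j ji; rewrite pr_fund eq_sym (negPf ji) mulr0.
  rewrite pr_fund eqxx mulr1 addr0 => ->.
  rewrite linear_sum /= sumr_ge0 // => j _.
  rewrite -scaler_nat linearZ /= [fund i (coroot j)]pr_fund.
  by apply: mulr_ge0; rewrite ler0n.
rewrite lt_def; apply/andP; split.
  apply/eqP => hi; have/eqP := alpha_neq0 i; apply.
  by apply: form_nondegenerate => y; rewrite -[LHS]/(form _ _) form_alphal hi mul0r.
by move: h0; rewrite pmulr_rge0 // ltr0n delta_coef_gt0.
Qed.

Lemma hnorm_dd (i : I) : (dd D)%:R * hnorm i \is a Num.int.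
Proof. exact: dd_form. Qed.

Lemma hnorm_ge (i : I) : 1 <= (dd D)%:R * hnorm i.
Proof.
have /intrP[m Em] := hnorm_dd i.
have : 0 < (dd D)%:R * hnorm i by rewrite mulr_gt0 ?hnorm_gt0 // ltr0n dd_gt0.
by rewrite Em ltr0z ler1z gtz0_ge1.
Qed.

(** With z_i = n_i / a_i, the norm of \sum_i n_i alpha_i is
    -1/2 \sum_(i, j) (alpha_i, alpha_j) a_i a_j (z_i - z_j)^2, because delta is
    in the radical; off the diagonal (alpha_i, alpha_j) <= 0. *)
Lemma form_root_ge0 (n : I -> rat) :
  0 <= form (\sum_i n i *: alpha i) (\sum_i n i *: alpha i).
Proof.
pose B (i j : I) := form (alpha i) (alpha j).
pose a (i : I) : rat := (delta_coef i)%:R.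
have a0 i : a i != 0 by rewrite pnatr_eq0 -lt0n delta_coef_gt0.
have B0 i : \sum_j B i j * a j = 0.
  transitivity (form (alpha i) delta); last by rewrite form_alphal pr_delta mulr0.
  rewrite form_sumr; apply: eq_bigr => j _.
  by rewrite -scaler_nat formZr mulrC.
have BC i j : B i j = B j i by exact: formC.
pose S := \sum_i \sum_j - B i j * (a i * a j * (n i / a i - n j / a j) ^+ 2).
suff -> : form (\sum_i n i *: alpha i) (\sum_i n i *: alpha i) = 2^-1 * S.
  apply: mulr_ge0; rewrite // /S; apply: sumr_ge0 => i _; apply: sumr_ge0 => j _.
  have [->|ij] := eqVneq i j; first by rewrite subrr expr0n mulr0 mulr0.
  apply: mulr_ge0; last by rewrite mulr_ge0 ?sqr_ge0 ?mulr_ge0 ?ler0n.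
  have [m Em] := pr_alpha_neg ij.
  by rewrite /B form_alphal Em -mulrN opprK mulr_ge0 ?ler0n // ltW // hnorm_gt0.
have -> : S = \sum_i \sum_j (2 * (n i * n j * B i j))
   - \sum_i (n i ^+ 2 / a i * \sum_j B i j * a j)
   - \sum_j (n j ^+ 2 / a j * \sum_i B j i * a i).
  pose C i := \sum_j n i ^+ 2 / a i * (B i j * a j).
  have EC i : n i ^+ 2 / a i * (\sum_j B i j * a j) = C i by rewrite mulr_sumr.
  rewrite [X in _ - X - _](eq_bigr C) // [X in _ - _ - X](eq_bigr C) // /C.
  rewrite [X in _ - _ - X]exchange_big /= -!sumrB; apply: eq_bigr => i _.
  rewrite -!sumrB; apply: eq_bigr => j _; rewrite (BC j i).
  by field; rewrite !a0.
rewrite [X in _ - X - _]big1 => [|i _]; last by rewrite B0 mulr0.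
rewrite [X in _ - _ - X]big1 => [|i _]; last by rewrite B0 mulr0.
rewrite !subr0 mulr_sumr form_suml; apply: eq_bigr => i _.
rewrite form_sumr mulr_sumr; apply: eq_bigr => j _.
by rewrite formZl formZr /B; field.
Qed.

(** Dimension count: the roots span a subspace of the level-zero hyperplane
    that has its dimension. *)
Lemma level0_root (i0 : I) x : level x = 0 ->
  exists n : I -> rat, x = \sum_i n i *: alpha i.
Proof.
move=> x0.
pose X := [seq @alpha D i | i : I].
pose lv := fun y : td => (level y : rat^o).
have lv_lin : linear lv.
  by move=> c y z; rewrite /lv levelD levelZ.
pose lvL := GRing.isLinear.Build rat td rat^o *:%R lv lv_lin.
pose lf : {linear td -> rat^o} := HB.pack lv lvL.
pose f : 'Hom(td, rat^o) := linfun lf.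
have fE y : f y = level y by rewrite lfunE.
have sub : (<<X>> <= lker f)%VS.
  apply/span_subvP => y /mapP[i _ ->].
  by rewrite memv_ker fE level_alpha.
have dimX : \dim <<X>> = #|I|.
  by rewrite (eqP (root_free D)) size_map -cardE.
have dimtd : \dim {:td} = #|I|.+1.
  by rewrite dimvf /dim /= -(dimvf t) cartan_dim muln1.
have dimk : (\dim (lker f) <= #|I|)%N.
  have := limg_ker_dim f fullv; rewrite capfv dimtd => E.
  have : (0 < \dim (f @: fullv))%N; last by lia.
  rewrite lt0n dimv_eq0; apply/eqP => im0.
  have : f (fund i0) \in (f @: fullv)%VS by rewrite memv_img ?memvf.
  rewrite im0 memv0 fE level_sum (bigD1 i0) //= big1; last first.
    by move=> j ji; rewrite pr_fund eq_sym (negPf ji) mulr0.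
  rewrite pr_fund eqxx mulr1 addr0 mulf_eq0 pnatr_eq0 => /orP[].
    by rewrite eqn0Ngt delta_coef_gt0.
  by rewrite gt_eqF // hnorm_gt0.
have spanE : (<<X>> == lker f)%VS by rewrite eqEdim sub dimX.
have : x \in <<X>>%VS by rewrite (eqP spanE) memv_ker fE x0.
rewrite /X span_def big_map big_enum /= => /memv_sumP[v Hv ->].
have /fin_all_exists[n En] : forall i, exists k, v i = k *: alpha i.
  move=> i; have : v i \in <[alpha i]>%VS by apply: Hv.
  by move/vlineP.
by exists n; apply: eq_bigr => i _; exact: En.
Qed.

Lemma level0_form_ge0 (i0 : I) x : level x = 0 -> 0 <= form x x.
Proof. by move=> /(level0_root i0)[n ->]; apply: form_root_ge0. Qed.

Lemma level0_radical (i0 : I) x : level x = 0 -> (forall i, pr i x = 0) ->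
  exists r, x = r *: delta.
Proof.
move=> /(level0_root i0)[n ->] n0.
have [u [u_gt0 u0 kerA]] := gcm_affine (cartan_affine D).
have [r Er] : exists r, forall i, n i = r * u i.
  apply: kerA => i; rewrite -[RHS](n0 i) pr_sum; apply: eq_bigr => j _.
  by rewrite prZ mulrC.
have [s Es] : exists r, forall i, (delta_coef i)%:R = r * u i.
  apply: kerA => i; rewrite -[RHS](pr_delta i) pr_sum; apply: eq_bigr => j _.
  by rewrite -scaler_nat prZ mulrC.
have s0 : s != 0.
  apply/eqP => s0; have := Es i0; rewrite s0 mul0r => /eqP.
  by rewrite pnatr_eq0 -leqn0 leqNgt delta_coef_gt0.
exists (r / s); rewrite /delta scaler_sumr; apply: eq_bigr => i _.
by rewrite -scaler_nat scalerA Es Er; congr (_ *: _); field.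
Qed.

Definition rho : td := \sum_i fund i.

Lemma pr_rho i : pr i rho = 1.
Proof.
rewrite pr_sum (bigD1 i) //= pr_fund eqxx big1 ?addr0 // => j ji.
by rewrite pr_fund (negPf ji).
Qed.

Lemma level_rho_gt0 (i0 : I) : 0 < level rho.
Proof.
have pos (i : I) : 0 < (delta_coef i)%:R * hnorm i * pr i rho.
  by rewrite pr_rho mulr1 mulr_gt0 ?hnorm_gt0 // ltr0n delta_coef_gt0.
rewrite level_sum (bigD1 i0) //= ltr_wpDr ?pos //.
by apply: sumr_ge0 => i _; apply: ltW.
Qed.

Lemma weyl_comp w w' : W w -> W w' -> W (w \o w')%VF.
Proof.
move=> Ww Ww'; elim: Ww => [|i v _ IH]; first by rewrite comp_lfun1l.
by rewrite -comp_lfunA; apply: weyl_refl.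
Qed.

Lemma weyl_srefl i : W (srefl i).
Proof. by rewrite -[srefl i]comp_lfun1r; apply: weyl_refl; apply: weyl_id. Qed.

Lemma weyl_inv w : W w -> exists2 w', W w' &
  (forall x, w' (w x) = x) /\ (forall x, w (w' x) = x).
Proof.
elim=> [|i v _ [v' Wv' [v'K vK']]].
  by exists \1%VF; [exact: weyl_id | split=> x; rewrite !lfunE].
exists (v' \o srefl i)%VF; first exact: weyl_comp (weyl_srefl i).
by split=> x; rewrite !comp_lfunE ?sreflK ?v'K ?vK' ?sreflK.
Qed.

Lemma form_weyl w x y : W w -> form (w x) (w y) = form x y.
Proof.
elim=> [|i v _ IH]; first by rewrite !lfunE.
by rewrite !comp_lfunE form_srefl.
Qed.

Lemma level_weyl w x : W w -> level (w x) = level x.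
Proof.
elim=> [|i v _ IH]; first by rewrite lfunE.
by rewrite comp_lfunE level_srefl.
Qed.

Lemma weyl_delta w : W w -> w delta = delta.
Proof.
elim=> [|i v _ IH]; first by rewrite lfunE.
by rewrite comp_lfunE IH sreflE pr_delta scale0r subr0.
Qed.

Lemma orbit_self (x : td) : weyl_orbit x x.
Proof. by exists \1%VF; [exact: weyl_id | rewrite lfunE]. Qed.

Lemma orbit_weyl w (x y : td) :
  W w -> weyl_orbit x y -> weyl_orbit x (w y).
Proof.
move=> Ww [v Wv <-]; exists (w \o v)%VF; first exact: weyl_comp.
by rewrite comp_lfunE.
Qed.

Lemma wlatticeD x y : P x -> P y -> P (x + y).
Proof.
have [b _ Hb] := wlattice_lattice D.
move=> /Hb[m ->] /Hb[n ->]; apply/Hb.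
exists [ffun i => m i + n i].
by rewrite -big_split; apply: eq_bigr => i _; rewrite ffunE mulrzDr.
Qed.

Lemma wlatticeN x : P x -> P (- x).
Proof.
have [b _ Hb] := wlattice_lattice D.
move=> /Hb[m ->]; apply/Hb; exists [ffun i => - m i].
by rewrite -sumrN; apply: eq_bigr => i _; rewrite ffunE mulrNz.
Qed.

Lemma wlatticeB x y : P x -> P y -> P (x - y).
Proof. by move=> Px Py; apply: wlatticeD => //; apply: wlatticeN. Qed.

Lemma wlatticeMn x n : P x -> P (x *+ n.+1).
Proof. by move=> Px; elim: n => [|n IH] //; rewrite mulrS; apply: wlatticeD. Qed.

Definition integral (x : td) := forall i, pr i x \is a Num.int.

Lemma wlattice_integral x : P x -> integral x.
Proof. by move=> Px i; apply: coroot_wlattice. Qed.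

Lemma integral_srefl i x : integral x -> integral (srefl i x).
Proof. by move=> ix j; rewrite sreflE prB prZ rpredB ?rpredM ?pr_alpha_int. Qed.

Lemma integral_weyl w x : W w -> integral x -> integral (w x).
Proof.
move=> Ww ix; elim: Ww => [|i v _ IH]; first by rewrite lfunE.
by rewrite comp_lfunE; apply: integral_srefl.
Qed.

Lemma wlattice_srefl i x : P x -> P (srefl i x).
Proof.
move=> Px; rewrite sreflE.
have /intrP[m ->] := wlattice_integral Px i.
rewrite scaler_int; apply: wlatticeB => //.
case: m => [[|n]|n]; rewrite ?NegzE ?mulrNz -?pmulrn.
- by rewrite mulr0n -(subrr x); apply: wlatticeB.
- by apply: wlatticeMn; apply: root_wlattice.
- by apply: wlatticeN; apply: wlatticeMn; apply: root_wlattice.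
Qed.

Lemma wlattice_weyl w x : W w -> P x -> P (w x).
Proof.
move=> Ww Px; elim: Ww => [|i v _ IH]; first by rewrite lfunE.
by rewrite comp_lfunE; apply: wlattice_srefl.
Qed.

Lemma int_ge1 (x : rat) : x \is a Num.int -> 0 < x -> 1 <= x.
Proof. by move=> /intrP[m ->]; rewrite ltr0z ler1z gtz0_ge1. Qed.

Lemma pr_hnorm_ge1 (i : I) (a : rat) :
  1 <= a -> 1 <= (dd D)%:R * (a * hnorm i).
Proof. by move=> a1; rewrite mulrCA; have := hnorm_ge i; nra. Qed.

(** ** Termination of reflection sequences *)

Lemma bounded_ind (T : Type) (Inv Pr : T -> Prop) (R : T -> T -> Prop)
    (m : T -> rat) :
  (forall x, Inv x -> 0 <= m x) ->
  (forall x y, Inv x -> R x y -> Inv y /\ m y <= m x - 1) ->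
  (forall x, Inv x -> (forall y, R x y -> Pr y) -> Pr x) ->
  forall x, Inv x -> Pr x.
Proof.
move=> m0 mR IH x; have [n] : exists n : nat, m x < n%:R.
  by exists (Num.truncn (m x)).+1; rewrite truncnS_gt.
elim: n x => [|n IHn] x mx Ix.
  by have := m0 x Ix; move: mx; rewrite mulr0n; lra.
apply: IH => // y Rxy; have [Iy my] := mR x y Ix Rxy.
by apply: IHn => //; move: mx my; rewrite -natr1; lra.
Qed.

(** The potential is -(rho, x): along s_i with <h_i, x> < 0 it drops by a
    definite amount, and it is bounded below on vectors of given level and
    norm, as the form is positive semidefinite on the level-zero vectors
    x - c rho. *)
Lemma pos_level_ind (i0 : I) (Pr : td -> Prop) :
  (forall x, integral x -> 0 < level x ->
     (forall i, pr i x < 0 -> Pr (srefl i x)) -> Pr x) ->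
  forall x, integral x -> 0 < level x -> Pr x.
Proof.
move=> IH x0 ix0 lx0.
have lr := level_rho_gt0 i0.
have [k k0 Ek] : exists2 k : rat, 0 < k & k * level rho = level x0.
  by exists (level x0 / level rho); rewrite ?divr_gt0 // divfK // gt_eqF.
pose Bd : rat := (form x0 x0 + k ^+ 2 * form rho rho) / (2 * k).
pose Inv x := [/\ integral x, level x = level x0 & form x x = form x0 x0].
pose R x y := exists2 i, pr i x < 0 & y = srefl i x.
apply: (@bounded_ind td Inv Pr R (fun x => (dd D)%:R * (Bd - form rho x))) => //.
- move=> x [ix lx nx]; rewrite mulr_ge0 ?ler0n // subr_ge0.
  have : 0 <= form (x - k *: rho) (x - k *: rho).
    by apply: (level0_form_ge0 i0); rewrite levelB levelZ lx Ek subrr.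
  rewrite !(formBl, formBr, formZl, formZr) nx (formC x rho) => h.
  rewrite /Bd ler_pdivlMr ?mulr_gt0 //; move: h; lra.
- move=> x _ [ix lx nx] [i xi ->]; split.
    by split; rewrite ?level_srefl ?form_srefl //; apply: integral_srefl.
  rewrite sreflE formBr formZr form_alphar pr_rho mulr1.
  have := @pr_hnorm_ge1 i (- pr i x) _; rewrite mulNr.
  suff h : 1 <= - pr i x by move=> /(_ h); nra.
  by apply: int_ge1; rewrite ?rpredN // oppr_gt0.
- move=> x [ix lx nx] Hx; apply: IH => //; first by rewrite lx.
  by move=> i xi; apply: Hx; exists i.
Qed.

End Geometry.
(** * Level zero: chamber walks, orbits modulo delta *)

(** Take y reachable from x with as few states reachable from it as possible. *)
Lemma recurrent_state (T : Type) (F : finType) (R : T -> T -> Prop)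
    (st : T -> F) :
  (forall x, R x x) -> (forall x y z, R x y -> R y z -> R x z) ->
  forall x, exists y, R x y /\
    forall z, R y z -> exists2 z', R z z' & st z' = st y.
Proof.
move=> Rxx Rtr x.
pose S y : {set F} := finset (fun f => `[< exists2 z, R y z & st z = f >]).
have [n] := ubnP #|S x|; elim: n x => // n IH x ltn.
have [good|] := pselect (forall z, R x z -> exists2 z', R z z' & st z' = st x).
  by exists x.
move=> /existsNP[z /not_implyP[Rxz nz]].
have sub : S z \proper S x.
  apply/properP; split.
    apply/fintype.subsetP => f; rewrite !inE => -[z' Rz Ef].
    by exists z' => //; apply: Rtr Rz.
  exists (st x); rewrite inE; first by apply/asboolP; exists x.
  by apply/negP => /asboolP[z' Rz Ef]; apply: nz; exists z'.
have [|y [Rzy Hy]] := IH z; first exact: leq_trans (proper_card sub) ltn.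
by exists y; split => //; apply: Rtr Rzy.
Qed.

Section LevelZero.
Variable D : affine_datum.
Local Notation I := (idx D).
Local Notation td := (dual (cartan D)).
Local Notation W := (@weyl D).

Section Walks.
Variable phi : td.

(** When phi is maximal at lambda on its orbit, <h_i, w phi> > 0 forces
    <h_i, w lambda> >= 0, so that the Demazure modules grow along these steps. *)
Inductive reach (w : 'End(td)) : 'End(td) -> Prop :=
| reach_refl : reach w w
| reach_step w' i : reach w w' -> 0 < pr i (w' phi) ->
    reach w (srefl i \o w')%VF.

Lemma reach_trans w1 w2 w3 : reach w1 w2 -> reach w2 w3 -> reach w1 w3.
Proof. by move=> r12; elim=> // w' i _ r13 pi; apply: reach_step. Qed.

Lemma reach_weyl w w' : reach w w' -> W w -> W w'.
Proof. by elim=> // w2 i _ IH _ Ww; apply: weyl_refl; apply: IH. Qed.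

(** Each step moves w phi by a negative multiple of a simple root. *)
Lemma reach_rho w w' : reach w w' ->
  form (rho D) (w' phi) <= form (rho D) (w phi).
Proof.
elim=> // w2 i _ IH pi; apply: le_trans IH.
rewrite comp_lfunE sreflE formBr formZr form_alphar pr_rho mulr1.
by have := hnorm_gt0 i; nra.
Qed.

Hypothesis phi0 : level phi = 0.
Hypothesis phi_int : integral phi.

Lemma pr_bound (i : I) (x : td) : level x = 0 ->
  pr i x ^+ 2 * hnorm i <= 2 * form x x.
Proof.
move=> x0.
have : 0 <= form (x - (pr i x / 2) *: alpha i) (x - (pr i x / 2) *: alpha i).
  by apply: (level0_form_ge0 i); rewrite levelB levelZ level_alpha x0; ring.
rewrite !(formBl, formBr, formZl, formZr) form_alphal !form_alphar pr_alphaii.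
by move=> h; rewrite -subr_ge0; apply: le_trans (_ : _ <= 2 * _) _;
  [exact: (mulr_ge0 _ h) | rewrite le_eqVlt; apply/orP; left; apply/eqP; field].
Qed.

(** The numbers <h_i, w phi> are integers, bounded since the form is positive
    semidefinite on level zero, and they determine w phi modulo delta. *)
Lemma finite_states : exists (F : finType) (st : 'End(td) -> F),
  forall w w', W w -> W w' -> st w = st w' ->
  exists r, w phi = w' phi + r *: delta D.
Proof.
have [i0 _|I0] := pickP {: I}; last first.
  exists unit, (fun=> tt) => w w' Ww Ww' _; exists 0; rewrite scale0r addr0.
  have wid v : W v -> v phi = phi.
    by case=> [|i]; [rewrite lfunE | have := I0 i].
  by rewrite !wid.
have [N HN] : exists N : nat, 2 * (dd D)%:R * form phi phi < N%:R.
  by exists (Num.truncn (2 * (dd D)%:R * form phi phi)).+1; rewrite truncnS_gt.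
have bnd w i : W w -> exists2 m : nat,
    pr i (w phi) = m%:R - N%:R & (m < (2 * N).+1)%N.
  move=> Ww; have /intrP[k Ek] := integral_weyl Ww phi_int i.
  have := @pr_bound i (w phi); rewrite level_weyl // form_weyl // => /(_ phi0).
  rewrite Ek => h.
  have kN : k ^+ 2 <= N.
    rewrite -(ler_int rat) rmorphXn /= -pmulrn ltW //.
    apply: le_lt_trans HN; rewrite -mulrA mulrCA.
    apply: le_trans (_ : (dd D)%:R * (k%:~R ^+ 2 * hnorm i) <= _).
      rewrite mulrCA; have := hnorm_ge i; have := sqr_ge0 (k%:~R : rat); nra.
    by rewrite ler_wpM2l ?ler0n.
  exists (absz (k + N%:Z)%R).
    have k0 : 0 <= k + N%:Z by nia.
    by rewrite natr_absz ger0_norm // rmorphD /= -pmulrn addrK.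
  by nia.
pose F := {ffun I -> 'I_(2 * N).+1}.
pose st (w : 'End(td)) : F :=
  [ffun i => inord (absz (Num.Def.floor (pr i (w phi) + N%:R)))].
exists F, st => w w' Ww Ww' /ffunP Est.
have [|i|r Er] := @level0_radical D i0 (w phi - w' phi).
- by rewrite levelB !level_weyl ?subrr.
- rewrite prB; have := Est i; rewrite !ffunE.
  have [m -> lem] := bnd w i Ww; have [m' -> lem'] := bnd w' i Ww'.
  rewrite !subrK !pmulrn !intrKfloor /= => /(congr1 val).
  by rewrite /= !inordK // => ->; rewrite subrr.
by exists r; rewrite -Er addrC subrK.
Qed.

Hypothesis phi_neq0 : exists i, pr i phi != 0.

(** Otherwise the walk never crosses wall i again; using only the other walls,
    w phi would decrease against a level-zero vector z pairing positively with
    the remaining simple roots, which must stop at a point where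
    <h_j, w phi> <= 0 for all j <> i. As the level is zero, <h_i, w phi> > 0
    there. *)
Lemma reach_fair w i : W w -> exists2 w', reach w w' & 0 < pr i (w' phi).
Proof.
move=> Ww.
pose c (k : I) : rat := (delta_coef k)%:R * hnorm k.
have c0 k : 0 < c k by rewrite mulr_gt0 ?hnorm_gt0 // ltr0n delta_coef_gt0.
(* The correction by the i-th fundamental weight brings z to level zero. *)
have [z prz z0] : exists2 z : td,
    (forall j, j != i -> pr j z = c i) & level z = 0.
  pose z : td :=
    c i *: (\sum_(j | j != i) fund j) - (\sum_(j | j != i) c j) *: fund i.
  have prz j : j != i -> pr j z = c i.
    move=> ji; rewrite prB !prZ pr_fund [i == j]eq_sym (negPf ji) mulr0 subr0.
    rewrite big_mkcond pr_sum (bigD1 j) //= ji pr_fund eqxx big1 ?addr0 ?mulr1 //.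
    by move=> k kj; case: ifP; rewrite ?pr0 // pr_fund (negPf kj).
  have przi : pr i z = - \sum_(j | j != i) c j.
    rewrite prB !prZ pr_fund eqxx mulr1 big_mkcond pr_sum big1 ?mulr0 ?sub0r //.
    by move=> k _; case: ifP; rewrite ?pr0 // => ki; rewrite pr_fund (negPf ki).
  have z0 : level z = 0.
    rewrite level_sum (bigD1 i) //= przi.
    have -> : \sum_(j | j != i) (delta_coef j)%:R * hnorm j * pr j z
        = (\sum_(j | j != i) c j) * c i.
      by rewrite mulr_suml; apply: eq_bigr => j ji; rewrite prz.
    by rewrite -[_ * hnorm i]/(c i) mulrN mulrC addNr.
  by exists z.
pose C : rat := (form phi phi + form z z) / 2.
pose R (w w' : 'End(td)) := exists j,
  [/\ j != i, 0 < pr j (w phi) & w' = (srefl j \o w)%VF].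
pose m (w : 'End(td)) : rat := (dd D)%:R * ((dd D)%:R * (form z (w phi) + C)).
move: w Ww; apply: (@bounded_ind _ W _ R m).
- move=> w Ww; rewrite !mulr_ge0 ?ler0n //.
  have : 0 <= form (w phi + z) (w phi + z).
    by apply: (level0_form_ge0 i); rewrite levelD level_weyl // phi0 z0 addr0.
  rewrite !(formDl, formDr) form_weyl // (formC (w phi) z) /C; lra.
- move=> w _ Ww [j [ji pj ->]]; split; first exact: weyl_refl.
  rewrite /m comp_lfunE sreflE formBr formZr form_alphar prz //.
  have p1 : 1 <= pr j (w phi).
    exact: int_ge1 (integral_weyl Ww phi_int j) pj.
  have h1 := pr_hnorm_ge1 j p1.
  have h2 : 1 <= (dd D)%:R * c i.
    have : 1 <= (delta_coef i)%:R :> rat by rewrite ler1n delta_coef_gt0.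
    exact: pr_hnorm_ge1.
  have : 1 <= ((dd D)%:R * (pr j (w phi) * hnorm j)) * ((dd D)%:R * c i).
    by move: h1 h2; nra.
  lra.
- move=> w Ww IH.
  have [[j [ji pj]]|nj] := pselect (exists j, j != i /\ 0 < pr j (w phi)).
    have [|w' r' pi] := IH (srefl j \o w)%VF; first by exists j.
    exists w' => //; apply: reach_trans r'; apply: reach_step pj.
    exact: reach_refl.
  have le0 j : j != i -> c j * pr j (w phi) <= 0.
    move=> ji; rewrite pmulr_rle0 // leNgt; apply/negP => pj; apply: nj.
    by exists j.
  exists w; first exact: reach_refl.
  have := level_sum (w phi); rewrite level_weyl // phi0 (bigD1 i) //=.
  move=> /eqP; rewrite eq_sym addr_eq0 -[_ * hnorm i]/(c i) => /eqP Es.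
  have s0 : \sum_(j | j != i) c j * pr j (w phi) <= 0 by apply: sumr_le0.
  rewrite lt_def -(pmulr_rge0 _ (c0 i)) Es oppr_ge0 s0 andbT.
  apply/eqP => pi0; move: Es; rewrite pi0 mulr0 => /esym/eqP; rewrite oppr_eq0.
  move=> sum0.
  have all0 j : j != i -> pr j (w phi) = 0.
    move=> ji; apply: (mulfI (lt0r_neq0 (c0 j))); rewrite mulr0.
    apply/eqP; rewrite -oppr_eq0; apply/eqP; move: j ji.
    have nneg j : j != i -> 0 <= - (c j * pr j (w phi)).
      by move=> ji; rewrite oppr_ge0 le0.
    by apply: (psumr_eq0P nneg); apply/eqP; rewrite sumrN oppr_eq0.
  have [||r Er] := @level0_radical D i (w phi).
  - by rewrite level_weyl.
  - by move=> j; have [->|/all0] := eqVneq j i.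
  have [v Wv [vK _]] := weyl_inv Ww.
  have [k /eqP] := phi_neq0; apply.
  by rewrite -(vK phi) Er linearZ /= weyl_delta // prZ pr_delta mulr0.
Qed.

Lemma reach_recurrent w : W w -> exists w0, [/\ W w0, reach w w0 &
  forall w1, reach w0 w1 -> exists2 w2, reach w1 w2 &
    exists r, w2 phi = w0 phi + r *: delta D].
Proof.
move=> Ww; have [F [st Hst]] := finite_states.
have [w0 [r0 H0]] := recurrent_state st reach_refl reach_trans w.
have W0 := reach_weyl r0 Ww.
exists w0; split=> // w1 r1; have [w2 r2 E2] := H0 w1 r1.
by exists w2 => //; apply: Hst => //; apply: reach_weyl r2 (reach_weyl r1 W0).
Qed.

(** A closed walk modulo delta strictly lowers the pairing with rho, so it
    translates some point of the orbit by a nonzero multiple of delta. *)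
Lemma orbit_delta : exists2 r : rat, r != 0 &
  forall x, weyl_orbit phi x -> forall k : nat,
    weyl_orbit phi (x + (k%:R * r) *: delta D) /\
    weyl_orbit phi (x - (k%:R * r) *: delta D).
Proof.
have [i _] := phi_neq0.
have [w0 [W0 _ rec]] := reach_recurrent (weyl_id D).
have [w1 r1 pi] := reach_fair i W0.
have W1 := reach_weyl r1 W0.
have r1' := reach_step r1 pi.
have [w2 r2 [r Er]] := rec _ r1'.
have W2 := reach_weyl r2 (weyl_refl i W1).
exists r.
  apply/eqP => r0.
  have := reach_rho r2; rewrite Er r0 scale0r addr0 => h2.
  have := reach_rho r1.
  move: h2; rewrite comp_lfunE sreflE formBr formZr form_alphar pr_rho mulr1.
  by have := hnorm_gt0 i; nra.
have [v0 V0 [v0K Kv0]] := weyl_inv W0.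
have shift x : weyl_orbit phi x ->
    weyl_orbit phi (x + r *: delta D) /\ weyl_orbit phi (x - r *: delta D).
  move=> [w Ww <-].
  have Wg := weyl_comp Ww V0.
  have [g' Wg' [g'K Kg']] := weyl_inv (weyl_comp W2 V0).
  have Eg : (w2 \o v0)%VF (w0 phi) = w0 phi + r *: delta D.
    by rewrite comp_lfunE v0K.
  have Eg' : g' (w0 phi) = w0 phi - r *: delta D.
    rewrite -[LHS](addrK (r *: delta D)); congr (_ - _).
    have -> : g' (w0 phi) + r *: delta D = g' (w0 phi + r *: delta D).
      by rewrite linearD linearZ /= weyl_delta.
    by rewrite -Eg g'K.
  split.
  - exists (w \o v0 \o w2)%VF; first exact: weyl_comp Wg W2.
    by rewrite !comp_lfunE Er !linearD !linearZ /= v0K !weyl_delta.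
  - exists (w \o v0 \o (g' \o w0))%VF.
      exact: weyl_comp Wg (weyl_comp Wg' W0).
    by rewrite !comp_lfunE Eg' !linearB !linearZ /= v0K !weyl_delta.
move=> x ox; elim=> [|k [IH1 IH2]].
  by rewrite mul0r scale0r subr0 addr0.
rewrite -natr1 mulrDl mul1r scalerDl opprD !addrA.
by have [? _] := shift _ IH1; have [_ ?] := shift _ IH2.
Qed.

Lemma orbit_finite : exists X : seq td,
  (forall x, x \in X -> weyl_orbit phi x) /\
  forall y, weyl_orbit phi y ->
    exists2 x, x \in X & exists r, y = x + r *: delta D.
Proof.
have [F [st Hst]] := finite_states.
have [rep Hrep] : exists rep : F -> 'End(td), forall f, W (rep f) /\
    forall w, W w -> st w = f -> st (rep f) = f.
  apply: (fin_all_exists (P := fun f (v : 'End(td)) => W v /\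
    forall w, W w -> st w = f -> st v = f)) => f.
  have [[w [Ww Ew]]|nw] := pselect (exists w, W w /\ st w = f).
    by exists w.
  exists \1%VF; split; first exact: weyl_id.
  by move=> w Ww Ew; case: nw; exists w.
exists [seq rep f phi | f <- enum F]; split.
  by move=> _ /mapP[f _ ->]; exists (rep f) => //; case: (Hrep f).
move=> _ [w Ww <-]; exists (rep (st w) phi).
  by apply/mapP; exists (st w); rewrite ?mem_enum.
have [Wr Er] := Hrep (st w).
by apply: Hst => //; rewrite (Er w).
Qed.

End Walks.

End LevelZero.

(** * Convex hulls and separation *)

Section ConeHull.
Variables (E : lmodType rat) (X : set E).

(** Keeping track of the total mass a of the coefficients makes this closed under
    sums; [convex_hull] is the case a = 1. *)
Definition hcone (a : rat) (x : E) : Prop := exists l : seq (rat * E),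
  [/\ (forall p, p \in l -> 0 <= p.1 /\ X p.2),
      a = \sum_(p <- l) p.1 & x = \sum_(p <- l) p.1 *: p.2].

Lemma hcone0 : hcone 0 0.
Proof. by exists [::]; rewrite !big_nil. Qed.

Lemma hcone_base x : X x -> hcone 1 x.
Proof.
move=> Xx; exists [:: (1, x)]; rewrite !big_seq1 scale1r; split=> //.
by move=> p; rewrite inE => /eqP ->.
Qed.

Lemma hconeD a b x y : hcone a x -> hcone b y -> hcone (a + b) (x + y).
Proof.
move=> [l [Hl -> ->]] [m [Hm -> ->]]; exists (l ++ m).
rewrite !big_cat; split=> // p; rewrite mem_cat => /orP[]; [exact: Hl | exact: Hm].
Qed.

Lemma hconeZ t a x : 0 <= t -> hcone a x -> hcone (t * a) (t *: x).
Proof.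
move=> t0 [l [Hl -> ->]]; exists [seq (t * p.1, p.2) | p <- l].
rewrite !big_map mulr_sumr scaler_sumr; split=> //.
- by move=> _ /mapP[p pl ->] /=; have [? ?] := Hl p pl; rewrite mulr_ge0.
- by apply: eq_bigr => p _; rewrite scalerA.
Qed.

Lemma sum_fibers (V : zmodType) (l : seq (rat * E)) (F : rat * E -> V) :
  \sum_(y <- undup [seq p.2 | p <- l]) \sum_(p <- l | p.2 == y) F p
  = \sum_(p <- l) F p.
Proof.
rewrite (exchange_big_dep xpredT) //= big_seq [RHS]big_seq.
apply: eq_bigr => p pl.
rewrite (big_rem p.2) /=; last by rewrite mem_undup; apply/mapP; exists p.
rewrite eqxx big_seq_cond big1 ?addr0 // => y /andP[yr /eqP py].
move: yr; rewrite -py rem_filter ?undup_uniq // mem_filter /=.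
by rewrite eqxx.
Qed.

Lemma hcone_hull x : hcone 1 x -> convex_hull X x.
Proof.
move=> [l [Hl E1 Ex]].
exists (undup [seq p.2 | p <- l]), (fun y => \sum_(p <- l | p.2 == y) p.1); split.
- move=> y; rewrite mem_undup => /mapP[p pl ->].
  have [_ ?] := Hl p pl; split=> //; rewrite big_seq_cond sumr_ge0 // => q.
  by move=> /andP[ql _]; have [] := Hl q ql.
- by rewrite sum_fibers.
- rewrite Ex -[LHS](sum_fibers l (fun p => p.1 *: p.2)); apply: eq_bigr => y _.
  by rewrite scaler_suml; apply: eq_bigr => p /eqP <-.
Qed.

Lemma hull_hcone x : convex_hull X x -> hcone 1 x.
Proof.
move=> [s [c [Hs s1 ->]]]; exists [seq (c y, y) | y <- s].
rewrite !big_map s1; split=> // _ /mapP[y ys ->] /=.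
by have [? ?] := Hs y ys.
Qed.

Lemma hull_base x : X x -> convex_hull X x.
Proof. by move=> Xx; apply/hcone_hull/hcone_base. Qed.

Lemma hull_conv x y t : convex_hull X x -> convex_hull X y -> 0 <= t <= 1 ->
  convex_hull X (t *: x + (1 - t) *: y).
Proof.
move=> /hull_hcone hx /hull_hcone hy /andP[t0 t1]; apply: hcone_hull.
have t1' : 0 <= 1 - t by rewrite subr_ge0.
by have := hconeD (hconeZ t0 hx) (hconeZ t1' hy); rewrite !mulr1 addrC subrK.
Qed.

Lemma hull_segment x (v : E) (n s : rat) : convex_hull X x ->
  convex_hull X (x - n *: v) -> 0 <= s <= n -> convex_hull X (x - s *: v).
Proof.
move=> hx hn /andP[s0 sn]; have [n0|n0] := eqVneq n 0.
  have -> : s = 0 by move: s0 sn; rewrite n0; lra.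
  by rewrite scale0r subr0.
have np : 0 < n by rewrite lt_def n0 (le_trans s0).
have -> : x - s *: v = (1 - s / n) *: x + (1 - (1 - s / n)) *: (x - n *: v).
  rewrite opprB addrCA subrr addr0 scalerBr scalerA divfK // addrA.
  by rewrite -scalerDl subrK scale1r.
apply: hull_conv => //; rewrite subr_ge0 ler_pdivrMr // mul1r sn /=.
by rewrite lerBlDl lerDr divr_ge0 // ltW.
Qed.

Lemma hcone_shift (d : E) r a x :
  (forall y, X y -> hcone 1 (y + r *: d)) ->
  hcone a x -> hcone a (x + (a * r) *: d).
Proof.
move=> Hd [l [Hl -> ->]]; elim: l Hl => [|p l IH] Hl.
  by rewrite !big_nil mul0r scale0r addr0; apply: hcone0.
rewrite !big_cons mulrDl scalerDl addrACA -scalerA -scalerDr.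
apply: hconeD; last by apply: IH => q ql; apply: Hl; rewrite inE ql orbT.
have [p0 Xp] := Hl p (mem_head _ _).
by have := hconeZ p0 (Hd _ Xp); rewrite mulr1.
Qed.

End ConeHull.

Lemma hcone_image (E : lmodType rat) (X Y : set E) a x (f : {linear E -> E}) :
  (forall y, X y -> Y (f y)) -> hcone X a x -> hcone Y a (f x).
Proof.
move=> fX [l [Hl -> ->]]; exists [seq (p.1, f p.2) | p <- l].
rewrite !big_map linear_sum; split=> //.
- by move=> _ /mapP[p pl ->] /=; have [? ?] := Hl p pl; split=> //; apply: fX.
- by apply: eq_bigr => p _; rewrite linearZ.
Qed.

Section Farkas.
Variables (E F : lmodType rat) (B : F -> E -> rat).
Hypothesis BDl : forall x y b, B (x + y) b = B x b + B y b.
Hypothesis BZl : forall a x b, B (a *: x) b = a * B x b.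
Hypothesis BDr : forall x b c, B x (b + c) = B x b + B x c.
Hypothesis BZr : forall a x b, B x (a *: b) = a * B x b.
Hypothesis B_nondeg : forall b, (forall z, B z b = 0) -> b = 0.

(** The nonnegative combinations of X, in the form consumed by induction on the
    list of generators. *)
Fixpoint cone (X : seq E) (b : E) : Prop :=
  if X is x :: X then exists c, 0 <= c /\ cone X (b - c *: x) else b = 0.

Lemma cone_project (x : E) (p : E -> rat) X : forall b,
  (forall y, y \in X -> 0 <= p y) ->
  cone [seq y + p y *: x | y <- X] b ->
  exists c, 0 <= c /\ cone X (b - c *: x).
Proof.
elim: X => [|y X IH] b Xp /=.
  by move=> ->; exists 0; rewrite scale0r subr0.
move=> [c [c0 Hc]].
have [|s [s0 Hs]] := IH _ _ Hc.
  by move=> z zX; apply: Xp; rewrite inE zX orbT.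
exists (s + c * p y); split.
  by rewrite addr_ge0 // mulr_ge0 // Xp ?mem_head.
exists c; split=> //; congr (cone X _): Hs.
rewrite scalerDr scalerDl scalerA !opprD -!addrA; congr (_ + _).
by rewrite addrC [RHS]addrA; congr (_ + _); rewrite addrC.
Qed.

(** Farkas' lemma by induction on the number of generators. If the functional
    z found for X is negative at the new generator x, project along x onto the
    kernel of z: the projections of X lie in the cone of x :: X. *)
Lemma farkas n : forall (X : seq E) b, size X = n ->
  cone X b \/ exists z, (forall x, x \in X -> 0 <= B z x) /\ B z b < 0.
Proof.
have BNl x b : B (- x) b = - B x b by rewrite -scaleN1r BZl mulN1r.
elim: n => [|n IH] [|x X] b //=.
  move=> _; have [->|b0] := eqVneq b 0; first by left.
  right; have [z /eqP Bz] : exists z, B z b <> 0.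
    by apply/existsNP => /B_nondeg /eqP; rewrite (negPf b0).
  move: Bz; rewrite neq_lt => /orP[Bz|Bz]; first by exists z.
  by exists (- z); rewrite BNl oppr_lt0.
move=> [sX]; have [cX|[z [zX zb]]] := IH X b sX.
  by left; exists 0; rewrite scale0r subr0.
have [zx|zx] := leP 0 (B z x).
  by right; exists z; split=> // y; rewrite inE => /predU1P[->|/zX].
have zx0 : B z x != 0 by rewrite lt_eqF.
pose p y := - (B z y / B z x).
have [|cX|[z' [zX' zb']]] := IH [seq y + p y *: x | y <- X] (b + p b *: x).
- by rewrite size_map.
- left; have [|c [c0 Hc]] := cone_project _ cX.
    move=> y /zX zy; by rewrite /p -mulrN mulr_ge0 // oppr_ge0 invr_le0 ltW.
  exists (c - p b); split; last by rewrite scalerBl opprB addrA.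
  rewrite subr_ge0; apply: le_trans c0.
  by rewrite oppr_le0 mulr_le0 ?invr_le0 // ltW.
- right; exists (z' - (B z' x / B z x) *: z).
  have Ez y : B (z' - (B z' x / B z x) *: z) y = B z' (y + p y *: x).
    by rewrite BDl BNl BZl BDr BZr /p; field.
  split; last by rewrite Ez.
  move=> y; rewrite inE => /predU1P[->|yX]; rewrite Ez.
    by rewrite /p divff // scaleN1r subrr -(scale0r x) BZr mul0r.
  by apply: zX'; apply/mapP; exists y.
Qed.

End Farkas.

Lemma seq_argmax (T : eqType) (f : T -> rat) (s : seq T) x0 : x0 \in s ->
  exists2 x, x \in s & forall y, y \in s -> f y <= f x.
Proof.
elim: s x0 => // x [|x1 s] IH x0 _.
  by exists x; rewrite ?mem_head // => y; rewrite inE => /eqP ->.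
have [y ys Hy] := IH x1 (mem_head _ _).
have [xy|yx] := leP (f x) (f y).
  exists y; first by rewrite inE ys orbT.
  by move=> z; rewrite inE => /predU1P[->|/Hy].
exists x; first exact: mem_head.
move=> z; rewrite inE => /predU1P[->//|/Hy zy].
exact: le_trans zy (ltW yx).
Qed.

Section Separation.
Variable D : affine_datum.
Local Notation td := (dual (cartan D)).
Local Notation W := (@weyl D).

Lemma form_nondeg (x : td) : (forall y, form y x = 0) -> x = 0.
Proof.
by move=> x0; apply: form_nondegenerate => y; rewrite -[LHS]/(form x y) formC x0.
Qed.

Lemma hull_weyl (x y : td) w : W w ->
  convex_hull (weyl_orbit x) y -> convex_hull (weyl_orbit x) (w y).
Proof.
move=> Ww /hull_hcone hy; apply: hcone_hull.
by apply: (@hcone_image _ _ _ _ _ w) hy => z; apply: orbit_weyl.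
Qed.

Variable lambda : td.
Hypothesis lambda0 : level lambda = 0.
Hypothesis lambda_int : integral lambda.
Hypothesis lambda_neq0 : exists i, pr i lambda != 0.

Local Notation O := (weyl_orbit lambda).

(** The orbit contains translates of x by multiples of delta on both sides of
    x + s delta. *)
Lemma orbit_line x s : O x -> hcone O 1 (x + s *: delta D).
Proof.
have [r r0 Hr] := orbit_delta lambda0 lambda_int lambda_neq0.
move=> Ox; pose k := (Num.truncn `|s / r|).+1.
have ks : `|s / r| < k%:R by rewrite truncnS_gt.
have [O1 O2] := Hr x Ox k.
have k0 : 0 < (k%:R : rat) by rewrite ltr0n.
pose t : rat := (1 + s / r / k%:R) / 2.
have kk : - 1 < s / r / k%:R < 1.
  by rewrite ltr_pdivrMr // ltr_pdivlMr // mul1r mulN1r -ltr_norml.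
apply: hull_hcone.
have -> : x + s *: delta D
    = t *: (x + (k%:R * r) *: delta D) + (1 - t) *: (x - (k%:R * r) *: delta D).
  rewrite !scalerDr scalerN !scalerA addrACA -scalerDl.
  rewrite (_ : t + (1 - t) = 1) ?scale1r; last by ring.
  congr (_ + _); rewrite -scaleNr -scalerDl; congr (_ *: _).
  by rewrite /t; field; rewrite r0 lt0r_neq0.
apply: hull_conv; [exact: hull_base | exact: hull_base |].
by move: kk; rewrite /t; set y := s / r / k%:R; lra.
Qed.

(** Farkas' lemma for representatives x of the orbit modulo delta, taken as
    points (x, 1), and the directions (delta, 0) and (- delta, 0): the latter
    cost nothing since the hull contains whole delta-lines, and they force the
    separating functional to have level zero. *)
Lemma orbit_separation mu : ~ convex_hull O mu ->
  exists phi, [/\ level phi = 0, integral phi & exists w, [/\ W w,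
    (forall w', W w' -> form phi (w' lambda) <= form phi (w lambda)) &
    form phi (w lambda) < form phi mu]].
Proof.
move=> nmu; have [X [XO OX]] := orbit_finite lambda0 lambda_int.
pose E : lmodType rat := (td * rat^o)%type.
pose B (z x : E) : rat := form z.1 x.1 + z.2 * x.2.
pose Y := [seq (x, 1) : E | x <- X] ++ [:: (delta D, 0) : E; (- delta D, 0) : E].
have BDl z z' x : B (z + z') x = B z x + B z' x.
  by rewrite /B /= formDl mulrDl addrACA.
have BZl a z x : B (a *: z) x = a * B z x.
  by rewrite /B /= formZl mulrDr mulrA.
have BDr z x x' : B z (x + x') = B z x + B z x'.
  by rewrite /B /= formDr mulrDr addrACA.
have BZr a z x : B z (a *: x) = a * B z x.
  by rewrite /B /= formZr mulrDr [in LHS]mulrCA.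
have Bnd x : (forall z, B z x = 0) -> x = 0.
  case: x => x s Bx; have Es : s = 0.
    by have := Bx (0, 1); rewrite /B /= form0l add0r mul1r.
  rewrite Es; congr pair; apply: form_nondeg => y.
  by have := Bx (y, 0); rewrite /B /= mul0r addr0.
have [cY|[[y s] [Yz zb]]] :=
    farkas BDl BZl BDr BZr Bnd (mu, 1 : rat^o) (erefl (size Y)).
- case: nmu; apply: hcone_hull.
  suff H : forall (Z : seq td) a x, (forall z, z \in Z -> O z) ->
      cone ([seq (z, 1) : E | z <- Z]
            ++ [:: (delta D, 0) : E; (- delta D, 0) : E]) (x, a) ->
      exists r, hcone O a (x + r *: delta D).
    have [r Hr] := H X 1 mu XO cY.
    have := @hcone_shift _ O (delta D) (- r) 1 _ (fun y => @orbit_line y _) Hr.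
    by rewrite mul1r scaleNr addrK.
  elim=> [|z Z IH] a x ZO /=.
    move=> [c [c0 [c' [c0' [/eqP]]]]].
    rewrite !scaler0 !subr0 => /eqP Ex ->; exists (c' - c).
    rewrite (_ : _ + _ = 0); first exact: hcone0.
    by rewrite -[RHS]Ex scalerBl scalerN opprK [X in _ + X]addrC addrA.
  move=> [c [c0 Hc]]; have [|r Hr] := IH _ _ _ Hc.
    by move=> z' zZ; apply: ZO; rewrite inE zZ orbT.
  exists r; have Oz := hcone_base (ZO z (mem_head _ _)).
  have := hconeD Hr (hconeZ c0 Oz).
  rewrite /= [X in hcone _ X _](_ : _ = a); last first.
    by rewrite -[X in _ - X + _]/(c * 1) subrK.
  by rewrite addrAC subrK.
have yd : level y = 0.
  have h1 : 0 <= B (y, s) (delta D, 0).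
    by apply: Yz; rewrite mem_cat !inE eqxx orbT.
  have h2 : 0 <= B (y, s) (- delta D, 0).
    by apply: Yz; rewrite mem_cat !inE eqxx !orbT.
  move: h1 h2; rewrite /B /= formNr !mulr0 !addr0 formC -/(level y); lra.
have [N N0 HN] := common_denominator (fun i => pr i (- y)).
pose phi := N%:R *: (- y).
have phi0 : level phi = 0 by rewrite levelZ levelN yd oppr0 mulr0.
have [x1 x1X _] := OX _ (orbit_self lambda).
have [x xX Hx] := seq_argmax (form phi) x1X.
have [w Ww Ew] := XO x xX.
exists phi; split=> //; first by move=> i; rewrite prZ.
exists w; split=> //.
- move=> w' Ww'; have [|z zX [r ->]] := OX (w' lambda); first by exists w'.
  rewrite formDr formZr [form phi (delta D)]formC -/(level phi) phi0 mulr0 addr0.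
  by rewrite Ew; apply: Hx.
- rewrite Ew !formZl ltr_pM2l ?ltr0n // !formNl ltrN2.
  have : 0 <= B (y, s) (x, 1).
    by apply: Yz; rewrite mem_cat; apply/orP; left; apply/mapP; exists x.
  by move: zb; rewrite /B /= !mulr1; lra.
Qed.

End Separation.

(** * Bounding the weights of Demazure modules *)

Section DemazureWeights.
Variable D : affine_datum.
Local Notation I := (idx D).
Local Notation td := (dual (cartan D)).
Local Notation W := (@weyl D).
(* wt w stands for the set of weights of U^+ u_w. *)
Variables (i0 : I) (lambda : td) (wt : 'End(td) -> td -> Prop).
Hypothesis wt_above : forall w mu, W w -> wt w mu ->
  exists2 n : I -> rat, (forall i, 0 <= n i) &
    mu - w lambda = \sum_i n i *: alpha i.
Hypothesis wt_incl : forall w i mu, W w -> 0 <= pr i (w lambda) ->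
  wt w mu -> wt (srefl i \o w)%VF mu.
Hypothesis wt_sym : forall w i mu, W w -> 0 <= pr i (w lambda) ->
  wt (srefl i \o w)%VF mu -> wt (srefl i \o w)%VF (srefl i mu).

Definition maximal_at (phi : td) (w : 'End(td)) :=
  forall w', W w' -> form phi (w' lambda) <= form phi (w lambda).

Lemma maximal_pr phi w i : W w -> maximal_at phi w -> 0 < pr i phi ->
  0 <= pr i (w lambda).
Proof.
move=> Ww mx pi; have := mx _ (weyl_refl i Ww).
rewrite comp_lfunE sreflE formBr formZr form_alphar.
have := hnorm_gt0 i; move=> hi; rewrite lerBlDr lerDl pmulr_lge0 //.
exact: mulr_gt0.
Qed.

Lemma maximal_srefl phi w i : W w -> maximal_at phi w ->
  maximal_at (srefl i phi) (srefl i \o w)%VF.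
Proof.
move=> Ww mx w' Ww'; rewrite comp_lfunE form_srefl.
have := mx _ (weyl_refl i Ww'); rewrite comp_lfunE.
by rewrite -[in X in X -> _](form_srefl i) sreflK.
Qed.

(** Walk on the straight line h - r phi. While it stays dominant the bound
    follows from [wt_above]; where it leaves the dominant chamber through wall
    i, one has <h_i, phi> > 0, hence <h_i, w lambda> >= 0 by maximality, and
    s_i carries the problem to s_i w. Starting the line at the first exit point
    keeps its origin dominant. *)
Lemma walk_bound x : integral x -> 0 < level x ->
  forall (h phi : td) w (r : rat),
  0 <= r -> (forall i, 0 <= pr i h) -> x = h - r *: phi ->
  W w -> maximal_at phi w -> forall mu, wt w mu ->
  0 <= form x (mu - w lambda).
Proof.
move: x; apply: (pos_level_ind i0) => x ix lx IH h phi w r r0 hdom Ex Ww mx mu wmu.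
have [[i xi]|dom] := pselect (exists i, pr i x < 0); last first.
  have [n n0 ->] := wt_above Ww wmu.
  rewrite form_sumr sumr_ge0 // => i _; rewrite formZr form_alphar.
  apply: mulr_ge0 => //; apply: mulr_ge0; first exact/ltW/hnorm_gt0.
  by rewrite leNgt; apply/negP => xi; apply: dom; exists i.
have phi_pos j : pr j x < 0 -> 0 < pr j phi.
  rewrite Ex prB prZ => xj; have hj := hdom j.
  by rewrite ltNge; apply/negP => phij; nra.
pose F (j : I) : rat := pr j h / pr j phi.
pose Pj (j : I) := 0 < pr j phi.
have Pi : Pj i by apply: phi_pos.
(* F j is the time at which the line meets wall j. *)
case: (Order.TotalTheory.arg_minP F Pi) => j Pjj jmin.
have Fj0 : 0 <= F j by rewrite divr_ge0 // ltW.
have Fjr : F j < r.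
  apply: le_lt_trans (jmin i Pi) _; rewrite ltr_pdivrMr //.
  by move: xi; rewrite Ex prB prZ; lra.
have EFj : F j * pr j phi = pr j h by rewrite divfK // gt_eqF.
have xj : pr j x < 0.
  have pj : 0 < pr j phi := Pjj.
  by rewrite Ex prB prZ; nra.
have wj : 0 <= pr j (w lambda) := maximal_pr Ww mx Pjj.
pose h1 := h - F j *: phi.
have h1j : pr j h1 = 0 by rewrite prB prZ EFj subrr.
have h1dom k : 0 <= pr k h1.
  rewrite prB prZ; have hk := hdom k.
  have [pk|pk] := ltP 0 (pr k phi); last by nra.
  have := jmin k pk; rewrite /F ler_pdivlMr //; lra.
have Esx : srefl j x = h1 - (r - F j) *: srefl j phi.
  have -> : x = h1 - (r - F j) *: phi.
    by rewrite Ex /h1 scalerBl opprB addrA subrK.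
  by rewrite linearB linearZ /= [srefl j h1]sreflE h1j scale0r subr0.
have := IH j xj _ _ _ _ _ h1dom Esx (weyl_refl j Ww) (maximal_srefl j Ww mx)
  _ (wt_sym Ww wj (wt_incl Ww wj wmu)).
rewrite comp_lfunE -linearB form_srefl; apply.
by rewrite subr_ge0 ltW.
Qed.

Lemma demazure_bound phi w mu : level phi = 0 -> integral phi -> W w ->
  maximal_at phi w -> wt w mu -> form phi mu <= form phi (w lambda).
Proof.
move=> phi0 iphi Ww mx wmu; rewrite -subr_le0 -formBr leNgt; apply/negP.
set xi := mu - _ => pos.
(* For this r the bound of [walk_bound] on rho - r phi fails. *)
pose r : rat := (Num.truncn `|form (rho D) xi / form phi xi|).+1%:R.
have r0 : 0 <= r by rewrite ler0n.
have dom i : 0 <= pr i (rho D) by rewrite pr_rho.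
have ix : integral (rho D - r *: phi).
  by move=> i; rewrite prB prZ pr_rho rpredB ?rpredM ?rpred1 ?natr_int.
have lx : 0 < level (rho D - r *: phi).
  by rewrite levelB levelZ phi0 mulr0 subr0 level_rho_gt0.
have := walk_bound ix lx r0 dom erefl Ww mx wmu.
rewrite -/xi formBl formZl subr_ge0 -ler_pdivlMr // leNgt => /negP; apply.
by apply: le_lt_trans (ler_norm _) _; rewrite truncnS_gt.
Qed.

End DemazureWeights.

(** * Weight vectors in modules *)

Lemma expfz_inj (F : fieldType) (q : F) : q != 0 ->
  (forall n, (0 < n)%N -> q ^+ n != 1) -> injective (fun n : int => q ^ n).
Proof.
move=> q0 qf m n /= E; apply/eqP; rewrite -subr_eq0; apply: contraT => mn.
have : q ^ (m - n) = 1 by rewrite expfzDr // E -expfzDr // subrr expr0z.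
move: mn; case: (m - n) => k.
  by case: k => // k _ /eqP; rewrite (negPf (qf k.+1 isT)).
by move=> _; rewrite NegzE -exprnN => /eqP; rewrite invr_eq1 (negPf (qf k.+1 isT)).
Qed.

Lemma prod_nat_neq0 (F : fieldType) (f : nat -> F) n :
  (forall k, (0 < k)%N -> f k != 0) -> \prod_(1 <= k < n.+1) f k != 0.
Proof.
move=> f0; rewrite prodf_seq_neq0; apply/allP => k.
by rewrite mem_index_iota => /andP[k_gt0 _]; apply: f0.
Qed.

Section Scalars.
Variable D : affine_datum.
Local Notation I := (idx D).
Local Notation t := (cartan D).
Local Notation td := (dual (cartan D)).
Local Notation P := (@wlattice D).

Lemma qs_neq0 : qs != 0.
Proof. by rewrite /qs tofrac_eq0 polyX_eq0. Qed.

Lemma qs_free (n : nat) : (0 < n)%N -> qs ^+ n != 1.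
Proof.
move=> n_gt0; rewrite /qs -tofracXn -tofrac1 tofrac_eq.
apply/eqP => /(congr1 (fun p : {poly rat} => size p)).
by rewrite size_polyXn size_poly1 => -[] n0; rewrite n0 in n_gt0.
Qed.

Lemma qpowD r s : (dd D)%:R * r \is a Num.int -> (dd D)%:R * s \is a Num.int ->
  qpow D (r + s) = qpow D r * qpow D s.
Proof.
move=> /intrP[m Em] /intrP[n En].
by rewrite /qpow mulrDr Em En -rmorphD /= !intrKfloor expfzDr ?qs_neq0.
Qed.

Lemma qpow_inj r s : (dd D)%:R * r \is a Num.int -> (dd D)%:R * s \is a Num.int ->
  qpow D r = qpow D s -> r = s.
Proof.
move=> /intrP[m Em] /intrP[n En].
rewrite /qpow Em En !intrKfloor => /(expfz_inj qs_neq0 qs_free) mn.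
have d0 : (dd D)%:R != 0 :> rat by rewrite pnatr_eq0 -lt0n dd_gt0.
by apply: (mulfI d0); rewrite Em En mn.
Qed.

Lemma qi_pow (i : I) : exists2 m : nat, (0 < m)%N & qi i = qs ^+ m.
Proof.
have /intrP[k Ek] := hnorm_dd i; have := hnorm_ge i; rewrite /qi /qpow Ek.
rewrite intrKfloor ler1z; case: k {Ek} => // k k1.
by exists k => //; lia.
Qed.

Lemma qi_free (i : I) (n : nat) : (0 < n)%N -> qi i ^+ n != 1.
Proof.
move=> n_gt0; have [m m_gt0 ->] := qi_pow i.
by rewrite -exprM qs_free // muln_gt0 m_gt0.
Qed.

Lemma qi_neq0 (i : I) : qi i != 0.
Proof. by have [m _ ->] := qi_pow i; rewrite expf_neq0 ?qs_neq0. Qed.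

Lemma qpow_hnorm (i : I) (n : int) : qpow D (hnorm i * n%:~R) = qi i ^ n.
Proof.
have /intrP[k Ek] := hnorm_dd i.
by rewrite /qi /qpow mulrA Ek -rmorphM /= !intrKfloor -exprz_exp.
Qed.

Lemma qintE (i : I) (n : nat) : qint i n = qnum (qi i) n.
Proof. by rewrite /qint /qnum -exprnN. Qed.

Lemma qfact_neq0 (i : I) n : qfact i n != 0.
Proof.
apply: prod_nat_neq0 => k k_gt0.
by rewrite qintE; apply: (@qnum_neq0 K (qi i) (@qi_free i) (qi_neq0 i)).
Qed.

Lemma coweight_int (h : t) (x : td) : coweight h -> P x ->
  (dd D)%:R * (x h : rat) \is a Num.int.
Proof. by move=> ch Px; have := ch x Px; rewrite linearZ. Qed.

Lemma coweightN (h : t) : coweight h -> coweight (- h).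
Proof. by move=> ch x Px; rewrite scalerN linearN rpredN; apply: ch. Qed.

Lemma coweight_ti (i : I) : coweight (ti i).
Proof.
move=> x Px; rewrite /ti scalerA linearZ.
by rewrite rpredM ?hnorm_dd //; apply: (wlattice_integral Px).
Qed.

(** A vector of t on which x and y differ becomes a coweight once rescaled to be
    integral on a basis of the weight lattice. *)
Lemma coweight_separates (x y : td) : P x -> P y -> x <> y ->
  exists2 h : t, coweight h & qpow D (x h) != qpow D (y h).
Proof.
move=> Px Py /eqP nxy.
have [h xyh] : exists h : t, x h != y h.
  apply: contrapT => /forallNP eqxy; move/eqP: nxy; apply; apply/lfunP => h.
  by apply/eqP; apply: contrapT => /negP; apply: eqxy.
have [b _ Pb] := wlattice_lattice D.
have [N N_gt0 HN] := common_denominator (fun i : 'I_(\dim {:td}) => b`_i h : rat).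
have ch : coweight (N%:R *: h).
  move=> z /Pb[a Ez].
  have -> : z ((dd D)%:R *: (N%:R *: h)) = (dd D)%:R * (N%:R * z h) :> rat.
    by rewrite !linearZ.
  rewrite rpredM ?natr_int // Ez sum_lfunE mulr_sumr rpred_sum // => i _.
  have -> : (b`_i *~ a i) h = (a i)%:~R * b`_i h :> rat.
    by rewrite -scaler_int scale_lfunE.
  by rewrite mulrCA rpredM ?intr_int.
exists (N%:R *: h) => //; apply: contra xyh => /eqP /qpow_inj E.
have := E (coweight_int ch Px) (coweight_int ch Py); rewrite !linearZ => E'.
have N0 : N%:R != 0 :> rat by rewrite pnatr_eq0 -lt0n.
by apply/eqP; apply: (mulfI N0).
Qed.

End Scalars.

Section Weights.
Variables (D : affine_datum) (V : uqModule D).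
Local Notation I := (idx D).
Local Notation t := (cartan D).
Local Notation td := (dual (cartan D)).
Local Notation P := (@wlattice D).
Implicit Types (mu nu : td) (v : V).

Lemma uq_qK (h : t) v : coweight h -> uq_q (- h) (uq_q h v) = v.
Proof.
by move=> ch; rewrite -uq_qD ?addNr ?uq_q0 //; apply: coweightN.
Qed.

Lemma wspaceD mu v v' : wspace mu v -> wspace mu v' -> wspace mu (v + v').
Proof.
move=> [Pm Hv] [_ Hv']; split=> // h ch.
by rewrite linearD Hv // Hv' // scalerDr.
Qed.

Lemma wspaceZ mu a v : wspace mu v -> wspace mu (a *: v).
Proof.
move=> [Pm Hv]; split=> // h ch.
by rewrite linearZ /= Hv // !scalerA mulrC.
Qed.

Lemma wspace0 mu : P mu -> wspace mu (0 : V).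
Proof. by move=> Pm; split=> // h ch; rewrite linear0 scaler0. Qed.

Lemma wspace_e i mu v : wspace mu v -> wspace (mu + alpha i) (uq_e i v).
Proof.
move=> [Pm Hv]; have Pa := root_wlattice i; split; first exact: wlatticeD.
move=> h ch; have := uq_qe i (uq_q h v) ch.
rewrite uq_qK // Hv // linearZ /= => ->.
by rewrite scalerA -qpowD ?add_lfunE 1?addrC //; apply: coweight_int.
Qed.

Lemma wspace_f i mu v : wspace mu v -> wspace (mu - alpha i) (uq_f i v).
Proof.
move=> [Pm Hv]; have Pa := root_wlattice i; split; first exact: wlatticeB.
move=> h ch; have := uq_qf i (uq_q h v) ch.
rewrite uq_qK // Hv // linearZ /= => ->.
rewrite scalerA -qpowD ?add_lfunE ?opp_lfunE 1?addrC ?mulrN ?rpredN //.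
  exact: coweight_int.
exact: coweight_int.
Qed.

Lemma ef_comm i mu v : wspace mu v ->
  uq_e i (uq_f i v) - uq_f i (uq_e i v)
  = qnum (qi i) (Num.floor (pr i mu)) *: v.
Proof.
move=> [Pm Hv]; rewrite uq_ef eqxx.
have ct := coweight_ti i.
rewrite !Hv //; last exact: coweightN.
have /intrP[m Em] := wlattice_integral Pm i.
have E1 : mu (ti i) = hnorm i * m%:~R :> rat by rewrite /ti linearZ -Em.
have E2 : mu (- ti i) = hnorm i * (- m)%:~R :> rat.
  transitivity (- (mu (ti i) : rat)); first by rewrite linearN.
  by rewrite E1 rmorphN mulrN.
by rewrite E1 E2 !qpow_hnorm Em intrKfloor -scalerBl scalerA mulrC.
Qed.

Lemma ef_comm_neq i j v : i != j -> uq_e i (uq_f j v) = uq_f j (uq_e i v).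
Proof.
by move=> ij; apply/eqP; rewrite -subr_eq0 uq_ef (negPf ij).
Qed.

Definition wstring i (n : int) v := exists2 mu, wspace mu v & pr i mu = n%:~R.

Lemma wstring_e i n v : wstring i n v -> wstring i (n + 2) (uq_e i v).
Proof.
move=> [mu Hv Em]; exists (mu + alpha i); first exact: wspace_e.
by rewrite prD pr_alphaii Em rmorphD.
Qed.

Lemma wstring_f i n v : wstring i n v -> wstring i (n - 2) (uq_f i v).
Proof.
move=> [mu Hv Em]; exists (mu - alpha i); first exact: wspace_f.
by rewrite prB pr_alphaii Em rmorphB.
Qed.

Lemma wstring_comm i n v : wstring i n v ->
  uq_e i (uq_f i v) - uq_f i (uq_e i v) = qnum (qi i) n *: v.
Proof. by move=> [mu Hv Em]; rewrite (ef_comm i Hv) Em intrKfloor. Qed.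

Lemma iter_f_neq0 i mu v (n N : nat) : wspace mu v -> pr i mu = n%:R ->
  iter N (uq_e i) v = 0 -> v != 0 -> iter n (uq_f i) v != 0.
Proof.
move=> Hv En eN; apply: contra => /eqP fn; apply/eqP.
apply: (@iter_f_inj K (qi i) (@qi_free D i) (qi_neq0 i) V (uq_e i) (uq_f i)
  (wstring i) (@wstring_e i) (@wstring_f i) (@wstring_comm i) N n) => //.
by exists mu.
Qed.

Lemma iter_e_neq0 i mu v (n N : nat) : wspace mu v -> pr i mu = - n%:R ->
  iter N (uq_f i) v = 0 -> v != 0 -> iter n (uq_e i) v != 0.
Proof.
move=> Hv En fN; apply: contra => /eqP en; apply/eqP.
apply: (@iter_f_inj K (qi i) (@qi_free D i) (qi_neq0 i) V (uq_f i) (uq_e i)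
  (fun n => wstring i (- n)) _ _ _ N n) => //.
- move=> m w /wstring_f; congr (wstring i _ _); lia.
- move=> m w /wstring_e; congr (wstring i _ _); lia.
- by move=> m w /wstring_comm E; rewrite -opprB E qnum_opp scaleNr opprK.
- by exists mu => //; rewrite rmorphN.
Qed.

(** ** Sums of weight vectors *)

Definition graded_sum (G : td -> V -> Prop) v := exists l : seq (td * V),
  (forall p, p \in l -> G p.1 p.2) /\ v = \sum_(p <- l) p.2.

Lemma graded_sum1 (G : td -> V -> Prop) mu v : G mu v -> graded_sum G v.
Proof.
move=> Gv; exists [:: (mu, v)]; rewrite big_seq1; split=> // p.
by rewrite inE => /eqP ->.
Qed.

Lemma graded_sum_map (G : td -> V -> Prop) (f : {linear V -> V}) v :
  (forall mu w, G mu w -> exists nu, G nu (f w)) ->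
  graded_sum G v -> graded_sum G (f v).
Proof.
move=> Gf [l [Hl ->]]; elim: l Hl => [|p l IH] Hl.
  by exists [::]; rewrite !big_nil linear0.
rewrite big_cons linearD.
have [|l' [Hl' ->]] := IH; first by move=> q ql; apply: Hl; rewrite inE ql orbT.
have [nu Gnu] := Gf _ _ (Hl p (mem_head _ _)).
exists ((nu, f p.2) :: l'); rewrite big_cons; split=> // q.
by rewrite inE => /predU1P[->|/Hl'].
Qed.

Lemma graded_sum_all (G : td -> V -> Prop) lambda (u : V) :
  (forall S : set V, uq_submodule S -> S u -> forall v, S v) ->
  (forall mu v, G mu v -> wspace mu v) ->
  (forall a mu v, G mu v -> G mu (a *: v)) ->
  (forall i mu v, G mu v -> G (mu + alpha i) (uq_e i v)) ->
  (forall i mu v, G mu v -> G (mu - alpha i) (uq_f i v)) ->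
  G lambda u -> forall v, graded_sum G v.
Proof.
move=> gen Gw GZ Ge Gf Gu; apply: gen; last exact: graded_sum1 Gu.
split.
- by exists [::]; rewrite big_nil.
- move=> _ _ [l [Hl ->]] [m [Hm ->]]; exists (l ++ m); rewrite big_cat.
  by split=> // p; rewrite mem_cat => /orP[/Hl|/Hm].
- move=> a _ [l [Hl ->]]; exists [seq (p.1, a *: p.2) | p <- l].
  rewrite big_map scaler_sumr; split=> // _ /mapP[p pl ->] /=.
  by apply: GZ; apply: Hl.
- by move=> i v; apply: graded_sum_map => mu w Gm; exists (mu + alpha i); apply: Ge.
- by move=> i v; apply: graded_sum_map => mu w Gm; exists (mu - alpha i); apply: Gf.
- move=> h v ch; apply: graded_sum_map => mu w Gm; exists mu.
  by have [_ ->] := Gw _ _ Gm; [apply: GZ | ].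
Qed.

(** For a coweight h separating mu from the weight of the first summand p, the
    operator q^h - q^<h, p.1> removes that summand and keeps v up to a nonzero
    scalar. *)
Lemma weight_indep n : forall (l : seq (td * V)) mu v, size l = n ->
  wspace mu v ->
  (forall p, p \in l -> wspace p.1 p.2 /\ p.1 <> mu) ->
  v = \sum_(p <- l) p.2 -> v = 0.
Proof.
elim: n => [|n IH] [|p l] mu v //; first by rewrite big_nil.
move=> [sl] Hv Hl; rewrite big_cons => Ev.
have [[Pp Hp] pmu] := Hl p (mem_head _ _).
have [h ch hne] := coweight_separates Hv.1 Pp (nesym pmu).
pose c := qpow D (mu h) - qpow D (p.1 h).
have c0 : c != 0 by rewrite subr_eq0.
suff : c *: v = 0 by move/eqP; rewrite scaler_eq0 (negPf c0) => /eqP.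
pose l' := [seq (q.1, (qpow D ((q.1 : td) h) - qpow D (p.1 h)) *: q.2)
  | q : td * V <- l].
have wl q : q \in l -> wspace q.1 q.2 /\ q.1 <> mu.
  by move=> ql; apply: Hl; rewrite inE ql orbT.
have Hl' q : q \in l' -> wspace q.1 q.2 /\ q.1 <> mu.
  by move=> /mapP[r rl ->] /=; have [? ?] := wl r rl; split=> //; apply: wspaceZ.
apply: (IH l' mu) Hl' _; rewrite ?size_map //; first exact: wspaceZ.
rewrite /l' big_map /=.
transitivity (uq_q h v - qpow D (p.1 h) *: v); first by rewrite Hv.2 // -scalerBl.
rewrite {}Ev linearD linear_sum /= Hp // scalerDr opprD addrACA subrr add0r.
rewrite scaler_sumr -sumrB big_seq [RHS]big_seq; apply: eq_bigr => q ql.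
by have [[_ Hq] _] := wl q ql; rewrite Hq // scalerBl.
Qed.

Lemma weight_component (G : td -> V -> Prop) mu v :
  (forall nu w, G nu w -> wspace nu w) -> wspace mu v -> v != 0 ->
  graded_sum G v -> exists2 w, w != 0 & G mu w.
Proof.
move=> Gw Hv v0 [l [Hl Ev]].
have [//|none] := pselect (exists2 w, w != 0 & G mu w).
have Emu : \sum_(p <- l | p.1 == mu) p.2 = 0.
  rewrite big_seq_cond big1 // => p /andP[pl /eqP Ep].
  apply/eqP; apply: contrapT => /negP p0; apply: none; exists p.2 => //.
  by rewrite -Ep; apply: Hl.
case/eqP: v0; apply: (weight_indep (l := [seq p <- l | p.1 != mu]) erefl Hv).
  move=> p; rewrite mem_filter => /andP[/eqP pm pl]; split=> //.
  by apply: Gw; apply: Hl.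
by rewrite big_filter Ev (bigID (fun p => p.1 == mu)) /= Emu add0r.
Qed.

(** ** Local nilpotency *)

Definition nilp (x : {linear V -> V}) v := exists N, iter N x v = 0.

Lemma iter_linear0 (x : {linear V -> V}) N : iter N x 0 = 0.
Proof. by elim: N => //= N ->; rewrite linear0. Qed.

Lemma iter_linearD (x : {linear V -> V}) N v w :
  iter N x (v + w) = iter N x v + iter N x w.
Proof. by elim: N => //= N ->; rewrite linearD. Qed.

Lemma iter_linearZ (x : {linear V -> V}) N a v :
  iter N x (a *: v) = a *: iter N x v.
Proof. by elim: N => //= N ->; rewrite linearZ. Qed.

Lemma iter_linear_ge (x : {linear V -> V}) N M v :
  iter N x v = 0 -> (N <= M)%N -> iter M x v = 0.
Proof. by move=> E NM; rewrite -(subnK NM) iterD E iter_linear0. Qed.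

Lemma nilpD x v w : nilp x v -> nilp x w -> nilp x (v + w).
Proof.
move=> [N EN] [M EM]; exists (maxn N M).
rewrite iter_linearD (iter_linear_ge EN) ?leq_maxl //.
by rewrite (iter_linear_ge EM) ?addr0 ?leq_maxr.
Qed.

Lemma nilpZ x a v : nilp x v -> nilp x (a *: v).
Proof. by move=> [N EN]; exists N; rewrite iter_linearZ EN scaler0. Qed.

Lemma nilp_sum x (J : eqType) (s : seq J) (F : J -> V) :
  (forall j, j \in s -> nilp x (F j)) -> nilp x (\sum_(j <- s) F j).
Proof.
elim: s => [|j s IH] Hs; first by exists 0%N; rewrite big_nil.
rewrite big_cons; apply: nilpD; first by apply: Hs; rewrite mem_head.
by apply: IH => k ks; apply: Hs; rewrite inE ks orbT.
Qed.

Lemma nilp_iter (x : {linear V -> V}) N v : nilp x (iter N x v) -> nilp x v.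
Proof. by move=> [M E]; exists (M + N)%N; rewrite iterD. Qed.

Lemma dpowE (i : I) (x : {linear V -> V}) n v :
  dpow i x n v = (qfact i n)^-1 *: iter n x v.
Proof. by []. Qed.

Lemma dpow0 (i : I) (x : {linear V -> V}) v : dpow i x 0 v = v.
Proof. by rewrite dpowE /qfact big_geq // invr1 scale1r. Qed.

(** The Serre relation writes e_i^(n+1) (e_j v) as a combination of vectors
    e_i^a (e_j (e_i^k v)) with k > 0, where induction on the nilpotency order
    of v applies. *)
Lemma nilp_ee i j v : nilp (uq_e i) v -> nilp (uq_e i) (uq_e j v).
Proof.
have [<-|ij] := eqVneq i j.
  by move=> [N E]; exists N; rewrite -iterSr /= E linear0.
have [n En] := pr_alpha_neg ij.
move=> [N]; elim: N v => [|N IH] v /= E; first by rewrite E linear0; exists 0%N.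
have := uq_serre_e v ij En; rewrite big_ord_recr /= subnn => /eqP.
rewrite addrC addr_eq0 => /eqP Es.
suff : nilp (uq_e i) (iter n.+1 (uq_e i) (uq_e j v)) by apply: nilp_iter.
have c0 : (-1) ^+ n.+1 * (qfact i n.+1)^-1 != 0 :> K.
  by rewrite mulf_neq0 ?signr_eq0 ?invr_eq0 ?qfact_neq0.
have -> : iter n.+1 (uq_e i) (uq_e j v)
    = ((-1) ^+ n.+1 * (qfact i n.+1)^-1)^-1 *:
      ((-1) ^+ n.+1 *: dpow i (uq_e i) n.+1 (uq_e j (dpow i (uq_e i) 0 v))).
  by rewrite dpow0 dpowE !scalerA -mulrA mulVf // scale1r.
rewrite Es; apply: nilpZ; rewrite -scaleN1r; apply: nilpZ.
apply: nilp_sum => k _; apply: nilpZ; rewrite dpowE; apply: nilpZ.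
rewrite dpowE linearZ /= iter_linearZ; apply: nilpZ.
have [M EM] : nilp (uq_e i) (uq_e j (iter (n.+1 - k) (uq_e i) v)).
  have kn := ltn_ord k; apply: IH; rewrite -iterD.
  by apply: (@iter_linear_ge _ N.+1) => //; lia.
by exists M; rewrite -iterD addnC iterD EM iter_linear0.
Qed.

(** For i = j the commutator [e_i, f_i] is a scalar on v, so e_i (f_i v) is
    a multiple of v plus f_i (e_i v), where induction on the nilpotency order
    applies. *)
Lemma nilp_ef i j mu v : wspace mu v -> nilp (uq_e i) v ->
  nilp (uq_e i) (uq_f j v).
Proof.
move=> Hv [N E]; have [<-|ij] := eqVneq i j; last first.
  exists N; suff -> : iter N (uq_e i) (uq_f j v) = uq_f j (iter N (uq_e i) v).
    by rewrite E linear0.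
  by elim: N {E} => //= N ->; rewrite ef_comm_neq.
elim: N mu v Hv E => [|N IH] mu v Hv E.
  by rewrite [v]E linear0; exists 0%N.
have [M EM] : nilp (uq_e i) (uq_f i (uq_e i v)).
  by apply: IH (wspace_e i Hv) _; rewrite -iterSr.
have /eqP := ef_comm i Hv; rewrite subr_eq => /eqP Ec.
suff : nilp (uq_e i) (uq_e i (uq_f i v)) by apply: (@nilp_iter _ 1).
rewrite Ec; apply: nilpD; last by exists M.
by apply: nilpZ; exists N.+1.
Qed.

End Weights.

(** * Exchanging e and f *)

Section Twist.
Variables (D : affine_datum) (V : uqModule D).
Local Notation t := (cartan D).
Local Notation td := (dual (cartan D)).

Lemma twist_q0 (v : V) : uq_q (- 0) v = v.
Proof. by rewrite oppr0 uq_q0. Qed.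

Lemma twist_qD (h h' : t) (v : V) : coweight h -> coweight h' ->
  uq_q (- (h + h')) v = uq_q (- h) (uq_q (- h') v).
Proof. by move=> ch ch'; rewrite opprD uq_qD //; apply: coweightN. Qed.

Lemma twist_qe (h : t) i (v : V) : coweight h ->
  uq_q (- h) (uq_f i (uq_q (- - h) v)) = qpow D (alpha i h) *: uq_f i v.
Proof. by move=> ch; rewrite uq_qf ?linearN ?opprK //; apply: coweightN. Qed.

Lemma twist_qf (h : t) i (v : V) : coweight h ->
  uq_q (- h) (uq_e i (uq_q (- - h) v))
  = qpow D (- (alpha i h : rat)) *: uq_e i v.
Proof. by move=> ch; rewrite uq_qe ?linearN //; apply: coweightN. Qed.

Lemma twist_ef i j (v : V) :
  uq_f i (uq_e j v) - uq_e j (uq_f i v) =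
  if i == j then
    (qi i - (qi i)^-1)^-1 *: (uq_q (- ti i) v - uq_q (- - ti i) v)
  else 0.
Proof.
rewrite -opprB uq_ef eq_sym; case: eqP => [->|_]; last by rewrite oppr0.
by rewrite opprK -scalerN opprB.
Qed.

(** The pullback of V by the Chevalley involution. It deduces statements on f from
    statements on e, and positive level from negative level. *)
Definition twist : uqModule D :=
  @UqModule D V (fun i => uq_f i) (fun i => uq_e i) (fun h => uq_q (- h))
    twist_q0 twist_qD twist_qe twist_qf twist_ef
    (@uq_serre_f D V) (@uq_serre_e D V).

Lemma twist_wspace (mu : td) (v : V) : wspace mu v ->
  wspace (- mu) (v : twist).
Proof.
move=> [Pm Hv]; split; first exact: wlatticeN.
move=> h ch; rewrite /= Hv; last exact: coweightN.
by rewrite opp_lfunE linearN.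
Qed.

Lemma twist_extremal (lambda : td) (u : V) : extremal lambda u ->
  extremal (- lambda) (u : twist).
Proof.
move=> [Hu [uw [uw1 Huw]]]; split; first exact: twist_wspace.
exists uw; split=> // w i n Ww; have [H1 H2] := Huw w i n Ww.
rewrite linearN opp_lfunE; split.
  by move=> E; apply: H2; rewrite -E opprK.
by move=> /oppr_inj E; apply: H1.
Qed.

Lemma twist_generated (u : V) :
  (forall S : set V, uq_submodule S -> S u -> forall v, S v) ->
  forall S : set twist, uq_submodule S -> S u -> forall v, S v.
Proof.
move=> gen S [S0 SD SZ Se Sf Sq]; apply: gen; split=> // h v ch Sv.
by have := Sq (- h) v (coweightN ch) Sv; rewrite /= opprK.
Qed.

End Twist.

(** At u either e_i u = 0, or e_i kills a divided power of e_i applied to u; the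
    Serre and commutation relations propagate this to V. *)
Lemma extremal_nilp_e (D : affine_datum) (V : uqModule D)
    (lambda : dual (cartan D)) (u : V) :
  wlattice lambda -> extremal lambda u ->
  (forall S : set V, uq_submodule S -> S u -> forall v, S v) ->
  forall i (v : V), nilp (uq_e i) v.
Proof.
move=> Pl [Hu [uw [uw1 Huw]]] gen i.
have nu : nilp (uq_e i) u.
  have /intrP[m Em] := wlattice_integral Pl i.
  have W1 := weyl_id D.
  case: m Em => n Em.
    have [H _] := Huw _ i n W1; rewrite uw1 lfunE /= in H.
    by have [Eu _] := H Em; exists 1%N.
  have [_ H] := Huw _ i n.+1 W1; rewrite uw1 lfunE /= in H.
  have [_ Eu] := H (etrans Em (etrans (congr1 intr (NegzE n)) (rmorphN _ _))).
  have [H' _] := Huw _ i n.+1 (weyl_refl i W1).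
  have Es : pr i ((srefl i \o \1)%VF lambda) = n.+1%:R.
    by rewrite !comp_lfunE lfunE /= pr_srefl Em NegzE rmorphN opprK.
  have [E0 _] := H' Es; move: E0; rewrite -Eu dpowE linearZ => /eqP.
  rewrite scaler_eq0 invr_eq0 (negPf (qfact_neq0 _ _)) => /eqP E0.
  by exists n.+2.
pose G mu (v : V) := wspace mu v /\ nilp (uq_e i) v.
move=> v; have [|||||l [Hl ->]] := @graded_sum_all D V G lambda u gen _ _ _ _ _ v.
- by move=> mu w [].
- by move=> a mu w [Hw nw]; split; [exact: wspaceZ | exact: nilpZ].
- by move=> j mu w [Hw nw]; split; [exact: wspace_e | exact: nilp_ee].
- by move=> j mu w [Hw nw]; split; [exact: wspace_f | exact: nilp_ef Hw nw].
- by [].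
by apply: nilp_sum => p /Hl[].
Qed.

(** * Modules generated by an extremal vector *)

Section Extremal.
Variables (D : affine_datum) (V : uqModule D).
Local Notation I := (idx D).
Local Notation td := (dual (cartan D)).
Local Notation P := (@wlattice D).
Local Notation W := (@weyl D).
Variables (lambda : td) (u : V) (uw : 'End(td) -> V).
Hypothesis lambdaP : P lambda.
Hypothesis u_wt : wspace lambda u.
Hypothesis uw1 : uw \1%VF = u.
Hypothesis uwP : forall w i (n : nat), W w ->
      (w lambda (coroot i) = n%:R ->
         uq_e i (uw w) = 0 /\
         dpow i (uq_f i) n (uw w) = uw (srefl i \o w)%VF) /\
      (w lambda (coroot i) = - n%:R ->
         uq_f i (uw w) = 0 /\
         dpow i (uq_e i) n (uw w) = uw (srefl i \o w)%VF).
Hypothesis gen :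
  forall S : set V, uq_submodule S -> S u -> forall v, S v.

Lemma u_extremal : extremal lambda u.
Proof. by split=> //; exists uw. Qed.

Lemma nilp_e i (v : V) : nilp (uq_e i) v.
Proof. exact: (extremal_nilp_e lambdaP u_extremal gen). Qed.

Lemma nilp_f i (v : V) : nilp (uq_f i) v.
Proof.
exact: (@extremal_nilp_e D (twist V) (- lambda) u (wlatticeN lambdaP)
  (twist_extremal u_extremal) (twist_generated gen) i v).
Qed.

Lemma uw_pos w i (n : nat) : W w -> pr i (w lambda) = n%:R ->
  uq_e i (uw w) = 0 /\ dpow i (uq_f i) n (uw w) = uw (srefl i \o w)%VF.
Proof. by move=> Ww; apply: (uwP i n Ww).1. Qed.

Lemma uw_neg w i (n : nat) : W w -> pr i (w lambda) = - n%:R ->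
  uq_f i (uw w) = 0 /\ dpow i (uq_e i) n (uw w) = uw (srefl i \o w)%VF.
Proof. by move=> Ww; apply: (uwP i n Ww).2. Qed.

Lemma srefl_compK i (w : 'End(td)) : (srefl i \o (srefl i \o w))%VF = w.
Proof. by rewrite comp_lfunA srefl_comp comp_lfun1l. Qed.

Lemma pr_weyl_nat w i : W w ->
  exists n : nat, pr i (w lambda) = n%:R \/ pr i (w lambda) = - n%:R.
Proof.
move=> Ww; have /intrP[[n|n] En] := wlattice_integral (wlattice_weyl Ww lambdaP) i.
  by exists n; left.
by exists n.+1; right; rewrite En NegzE rmorphN.
Qed.

Lemma wspace_iter_e i mu (v : V) n : wspace mu v ->
  wspace (mu + alpha i *+ n) (iter n (uq_e i) v).
Proof.
move=> Hv; elim: n => [|n IH] /=; first by rewrite addr0.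
by rewrite mulrSr addrA; apply: wspace_e.
Qed.

Lemma wspace_iter_f i mu (v : V) n : wspace mu v ->
  wspace (mu - alpha i *+ n) (iter n (uq_f i) v).
Proof.
move=> Hv; elim: n => [|n IH] /=; first by rewrite subr0.
by rewrite mulrSr opprD addrA; apply: wspace_f.
Qed.

Lemma srefl_pos i (x : td) (n : nat) : pr i x = n%:R ->
  srefl i x = x - alpha i *+ n.
Proof. by move=> E; rewrite sreflE E scaler_nat. Qed.

Lemma srefl_neg i (x : td) (n : nat) : pr i x = - n%:R ->
  srefl i x = x + alpha i *+ n.
Proof. by move=> E; rewrite sreflE E scaleNr opprK scaler_nat. Qed.

Lemma uw_wspace w : W w -> wspace (w lambda) (uw w).
Proof.
elim=> [|i v Wv IH]; first by rewrite uw1 lfunE.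
rewrite comp_lfunE; have [n [En|En]] := pr_weyl_nat i Wv.
  have [_ <-] := uw_pos Wv En; rewrite (srefl_pos En).
  by apply: wspaceZ; apply: wspace_iter_f.
have [_ <-] := uw_neg Wv En; rewrite (srefl_neg En).
by apply: wspaceZ; apply: wspace_iter_e.
Qed.

Definition is_weight (mu : td) := exists2 v : V, v != 0 & wspace mu v.

Lemma is_weight_srefl i mu : is_weight mu -> is_weight (srefl i mu).
Proof.
move=> [v v0 Hv]; have /intrP[[n|n] En] := wlattice_integral Hv.1 i.
- have [N EN] := nilp_e i v; exists (iter n (uq_f i) v).
    exact: (iter_f_neq0 Hv En EN).
  by rewrite (srefl_pos En); apply: wspace_iter_f.
- have En' : pr i mu = - n.+1%:R by rewrite En NegzE rmorphN.
  have [N EN] := nilp_f i v; exists (iter n.+1 (uq_e i) v).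
    exact: (iter_e_neq0 Hv En' EN).
  by rewrite (srefl_neg En'); apply: wspace_iter_e.
Qed.

Lemma is_weight_weyl w mu : W w -> is_weight mu -> is_weight (w mu).
Proof.
move=> Ww Hm; elim: Ww => [|i v _ IH]; first by rewrite lfunE.
by rewrite comp_lfunE; apply: is_weight_srefl.
Qed.

Lemma is_weight_graded (G : td -> V -> Prop) nu (v0 : V) :
  (forall S : set V, uq_submodule S -> S v0 -> forall v, S v) ->
  (forall mu v, G mu v -> wspace mu v) ->
  (forall a mu v, G mu v -> G mu (a *: v)) ->
  (forall i mu v, G mu v -> G (mu + alpha i) (uq_e i v)) ->
  (forall i mu v, G mu v -> G (mu - alpha i) (uq_f i v)) ->
  G nu v0 ->
  forall mu, is_weight mu -> exists2 v, v != 0 & G mu v.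
Proof.
move=> gen0 Gw GZ Ge Gf Gu mu [v vn Hv]; apply: (weight_component Gw Hv vn).
exact: (graded_sum_all gen0 Gw GZ Ge Gf Gu).
Qed.

Lemma is_weight_level mu : is_weight mu -> level mu = level lambda.
Proof.
pose G nu (v : V) := wspace nu v /\ level nu = level lambda.
move=> /(@is_weight_graded G lambda u gen); case.
- by move=> nu v [].
- by move=> a nu v [? ?]; split=> //; apply: wspaceZ.
- move=> i nu v [? ?]; split; first exact: wspace_e.
  by rewrite levelD level_alpha addr0.
- move=> i nu v [? ?]; split; first exact: wspace_f.
  by rewrite levelB level_alpha subr0.
- by [].
- by move=> v _ [].
Qed.

(** ** The Demazure modules U^+ u_w *)

(** The weight spaces of U^+ u_w. *)
Inductive up (w : 'End(td)) : td -> V -> Prop :=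
| up_base : up w (w lambda) (uw w)
| up_0 mu : P mu -> up w mu 0
| up_D mu v v' : up w mu v -> up w mu v' -> up w mu (v + v')
| up_Z a mu v : up w mu v -> up w mu (a *: v)
| up_e i mu v : up w mu v -> up w (mu + alpha i) (uq_e i v).

Lemma up_cast w mu nu v : up w mu v -> mu = nu -> up w nu v.
Proof. by move=> H <-. Qed.

Lemma up_wspace w mu v : W w -> up w mu v -> wspace mu v.
Proof.
move=> Ww; elim=> [|nu Pn|nu x y _ Hx _ Hy|a nu x _ Hx|i nu x _ Hx].
- exact: uw_wspace.
- exact: wspace0.
- exact: wspaceD.
- exact: wspaceZ.
- exact: wspace_e.
Qed.

Lemma add_neq0 (x y : V) : x + y != 0 -> x != 0 \/ y != 0.
Proof.
have [->|] := eqVneq x 0; first by rewrite add0r; right.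
by left.
Qed.

Lemma scale_neq0 a (x : V) : a *: x != 0 -> x != 0.
Proof. by apply: contraNneq => ->; rewrite scaler0. Qed.

Lemma e_neq0 i (x : V) : uq_e i x != 0 -> x != 0.
Proof. by apply: contraNneq => ->; rewrite linear0. Qed.

Lemma up_above w mu v : W w -> up w mu v -> v != 0 ->
  exists2 n : I -> rat, (forall i, 0 <= n i) &
    mu - w lambda = \sum_i n i *: alpha i.
Proof.
move=> Ww; elim=> [|nu Pn|nu x y _ Hx _ Hy|a nu x _ Hx|i nu x _ Hx].
- move=> _; exists (fun=> 0) => //.
  by rewrite subrr big1 // => i _; rewrite scale0r.
- by rewrite eqxx.
- by case/add_neq0; [exact: Hx | exact: Hy].
- by move/scale_neq0; apply: Hx.
- move/e_neq0 => /Hx[n n0 En].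
  exists (fun j => n j + (j == i)%:R); first by move=> j; rewrite addr_ge0 ?ler0n.
  rewrite addrAC En.
  rewrite [RHS](eq_bigr (fun j => n j *: alpha j + (j == i)%:R *: alpha j)).
    rewrite big_split /=; congr (_ + _).
    rewrite (bigD1 i) //= eqxx scale1r big1 ?addr0 // => j ji.
    by rewrite (negPf ji) scale0r.
  by move=> j _; rewrite scalerDl.
Qed.

Lemma up_iter_e w i mu v n : up w mu v ->
  up w (mu + alpha i *+ n) (iter n (uq_e i) v).
Proof.
move=> Hv; elim: n => [|n IH] /=; first by rewrite addr0.
by rewrite mulrSr addrA; apply: up_e.
Qed.

(** By extremality u_w is a divided power of e_i applied to u_(s_i w). *)
Lemma up_incl w i mu v : W w -> 0 <= pr i (w lambda) ->
  up w mu v -> up (srefl i \o w)%VF mu v.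
Proof.
move=> Ww pos; elim=> [|nu Pn|nu x y _ Hx _ Hy|a nu x _ Hx|j nu x _ Hx].
- have /intrP[m Em] := wlattice_integral (wlattice_weyl Ww lambdaP) i.
  have [n En] : exists n : nat, pr i (w lambda) = n%:R.
    by move: pos; rewrite Em ler0z; case: m {Em} => // n _; exists n.
  have Ens : pr i ((srefl i \o w)%VF lambda) = - n%:R.
    by rewrite comp_lfunE pr_srefl En.
  have [_] := uw_neg (weyl_refl i Ww) Ens; rewrite srefl_compK => <-.
  apply: up_Z; apply: up_cast (up_iter_e i n (up_base _)) _.
  by rewrite -(srefl_neg Ens) comp_lfunE sreflK.
- exact: up_0.
- exact: up_D.
- exact: up_Z.
- exact: up_e.
Qed.

(** f_i kills the generator, and f_i e_j - e_j f_i acts on weight vectors by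
    scalars. *)
Lemma up_f w i mu v : W w -> pr i (w lambda) <= 0 ->
  up w mu v -> up w (mu - alpha i) (uq_f i v).
Proof.
move=> Ww neg; elim=> [|nu Pn|nu x y _ Hx _ Hy|a nu x _ Hx|j nu x Ux Hx].
- have /intrP[m Em] := wlattice_integral (wlattice_weyl Ww lambdaP) i.
  have [n En] : exists n : nat, pr i (w lambda) = - n%:R.
    have := neg; rewrite Em lerz0; case: m {Em} => [[|n]|n] // _.
      by exists 0%N; rewrite oppr0.
    by exists n.+1; rewrite NegzE rmorphN.
  have [-> _] := uw_neg Ww En; apply: up_0.
  exact: wlatticeB (wlattice_weyl Ww lambdaP) (root_wlattice i).
- by rewrite linear0; apply/up_0/wlatticeB => //; apply: root_wlattice.
- by rewrite linearD; apply: up_D.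
- by rewrite linearZ; apply: up_Z.
- have Ue := up_e j Hx.
  have [Eij|ij] := eqVneq j i; last first.
    by rewrite -ef_comm_neq //; apply: up_cast Ue _; rewrite addrAC.
  rewrite Eij in Ue *; have Hn := up_wspace Ww Ux.
  have /eqP := ef_comm i Hn; rewrite subr_eq addrC -subr_eq => /eqP <-.
  rewrite addrK; apply: up_D; first by apply: up_cast Ue _; rewrite subrK.
  by rewrite -scaleNr; apply: up_Z.
Qed.

Lemma up_iter_f w i mu v n : W w -> pr i (w lambda) <= 0 -> up w mu v ->
  up w (mu - alpha i *+ n) (iter n (uq_f i) v).
Proof.
move=> Ww neg Hv; elim: n => [|n IH] /=; first by rewrite subr0.
by rewrite mulrSr opprD addrA; apply: up_f.
Qed.

Definition up_weight w mu := exists2 v, v != 0 & up w mu v.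

Lemma up_weight_above w mu : W w -> up_weight w mu ->
  exists2 n : I -> rat, (forall i, 0 <= n i) &
    mu - w lambda = \sum_i n i *: alpha i.
Proof. by move=> Ww [v v0 Uv]; apply: up_above Ww Uv v0. Qed.

Lemma up_weight_incl w i mu : W w -> 0 <= pr i (w lambda) ->
  up_weight w mu -> up_weight (srefl i \o w)%VF mu.
Proof. by move=> Ww pos [v v0 Uv]; exists v => //; apply: up_incl. Qed.

Lemma up_weight_sym w i mu : W w -> 0 <= pr i (w lambda) ->
  up_weight (srefl i \o w)%VF mu -> up_weight (srefl i \o w)%VF (srefl i mu).
Proof.
move=> Ww pos [v v0 Uv].
have Wsw := weyl_refl i Ww; have Hv := up_wspace Wsw Uv.
have /intrP[[n|n] En] := wlattice_integral Hv.1 i.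
- have [N EN] := nilp_e i v; exists (iter n (uq_f i) v).
    exact: (iter_f_neq0 Hv En EN).
  rewrite (srefl_pos En); apply: up_iter_f => //.
  by rewrite comp_lfunE pr_srefl oppr_le0.
- have En' : pr i mu = - n.+1%:R by rewrite En NegzE rmorphN.
  have [N EN] := nilp_f i v; exists (iter n.+1 (uq_e i) v).
    exact: (iter_e_neq0 Hv En' EN).
  by rewrite (srefl_neg En'); apply: up_iter_e.
Qed.

(** ** Negative level *)

Lemma up_peel w mu v : W w -> up w mu v -> v != 0 ->
  mu = w lambda \/ exists i, exists2 v', up w (mu - alpha i) v' & uq_e i v' != 0.
Proof.
move=> Ww; elim=> [|nu Pn|nu x y _ Hx _ Hy|a nu x _ Hx|i nu x Ux Hx].
- by left.
- by rewrite eqxx.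
- by case/add_neq0; [exact: Hx | exact: Hy].
- by move/scale_neq0; apply: Hx.
- by move=> ex; right; exists i, x => //; apply: up_cast Ux _; rewrite addrK.
Qed.

(** Divided powers lead from u_w back to u along the Weyl group. *)
Lemma uw_generates w (S : set V) : W w -> uq_submodule S -> S (uw w) -> S u.
Proof.
move=> Ww [S0 SD SZ Se Sf Sq]; elim: Ww => [|i v Wv IH]; first by rewrite uw1.
move=> Sv; apply: IH; have Wsv := weyl_refl i Wv.
rewrite -(srefl_compK i v); have [n [En|En]] := pr_weyl_nat i Wsv.
  have [_ <-] := uw_pos Wsv En; apply: SZ.
  by elim: n {En} => // n IH; apply: Sf.
have [_ <-] := uw_neg Wsv En; apply: SZ.
by elim: n {En} => // n IH; apply: Se.
Qed.

Lemma antidominant_orbit (i0 : I) : level lambda < 0 ->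
  exists2 w, W w & forall i, pr i (w lambda) <= 0.
Proof.
move=> neg.
pose Pr (x : td) := exists2 w, W w & forall i, 0 <= pr i (w x).
have [|||w Ww Hw] := @pos_level_ind D i0 Pr _ (- lambda).
- move=> x ix lx IH; have [[i xi]|dom] := pselect (exists i, pr i x < 0).
    have [w Ww Hw] := IH i xi; exists (w \o srefl i)%VF.
      exact: weyl_comp (weyl_srefl i).
    by move=> j; rewrite comp_lfunE.
  exists \1%VF; first exact: weyl_id.
  by move=> i; rewrite lfunE /= leNgt; apply/negP => xi; apply: dom; exists i.
- by move=> i; rewrite prN rpredN; apply: wlattice_integral.
- by rewrite levelN oppr_gt0.
by exists w => // i; have := Hw i; rewrite linearN prN oppr_ge0.
Qed.

(** If w lambda is antidominant then U^+ u_w is everything, and induction on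
    the height above w lambda applies: for mu = nu + alpha_i with nu a weight,
    either mu lies between nu and s_i nu, or s_i mu is lower than mu. *)
Lemma negative_level_hull (i0 : I) mu : level lambda < 0 -> is_weight mu ->
  convex_hull (weyl_orbit lambda) mu.
Proof.
move=> neg; have [w Ww anti] := antidominant_orbit i0 neg.
have upP nu : is_weight nu -> up_weight w nu.
  apply: (is_weight_graded (nu := w lambda) (v0 := uw w)).
  - move=> S subS Su; apply: gen => //; exact: uw_generates subS Su.
  - by move=> ka v; apply: up_wspace.
  - by move=> a ka v; apply: up_Z.
  - by move=> i ka v; apply: up_e.
  - by move=> i ka v; apply: up_f.
  - exact: up_base.
pose m (nu : td) : rat := (dd D)%:R * form (nu - w lambda) (rho D).
pose R (nu nu' : td) := is_weight nu' /\ m nu' <= m nu - 1.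
have mB nu (c : rat) i : 1 <= c -> m (nu - c *: alpha i) <= m nu - 1.
  move=> c1; rewrite /m addrAC formBl formZl form_alphal pr_rho mulr1 mulrBr.
  by rewrite lerD2l lerN2; apply: pr_hnorm_ge1.
move: mu; apply: (@bounded_ind td is_weight _ R m).
- move=> nu /upP /(up_weight_above Ww)[n n0 En]; rewrite /m En mulr_ge0 ?ler0n //.
  rewrite form_suml sumr_ge0 // => i _; rewrite formZl form_alphal pr_rho mulr1.
  by apply: mulr_ge0 => //; apply/ltW/hnorm_gt0.
- by move=> x y _ [].
move=> mu wmu IH; have [v v0 Uv] := upP _ wmu.
have [->|[i [v' Uv' ev']]] := up_peel Ww Uv v0.
  by apply: hull_base; exists w.
set nu := mu - alpha i in Uv'.
have Emu : mu = nu + alpha i by rewrite subrK.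
have wnu : is_weight nu by exists v'; [exact: e_neq0 ev' | exact: up_wspace Uv'].
have hnu : convex_hull (weyl_orbit lambda) nu.
  by apply: IH; split=> //; rewrite /nu -[alpha i]scale1r; apply: mB.
have /intrP[p Ep] : pr i nu \is a Num.int.
  by have [x _ Hx] := wnu; apply: wlattice_integral Hx.1 i.
have [p0|p0] := leP 0 p.
  rewrite -(sreflK i mu); apply: (hull_weyl (weyl_srefl i)); apply: IH.
  split; first exact: is_weight_srefl.
  rewrite [srefl i mu]sreflE; apply: mB.
  by rewrite Emu prD pr_alphaii Ep -(ler_int rat) in p0 *; lra.
have -> : mu = nu - 1 *: (- alpha i) by rewrite scale1r opprK.
have hs : convex_hull (weyl_orbit lambda) (nu - (- p%:~R) *: (- alpha i)).
  by rewrite scaleNr scalerN opprK -Ep -sreflE; apply: hull_weyl (weyl_srefl i) hnu.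
apply: hull_segment hnu hs _; rewrite ler01 -rmorphN ler1z /=.
by move: p0; lia.
Qed.

(** ** Level zero *)

Lemma trivial_hull mu : (forall i, pr i lambda = 0) -> is_weight mu ->
  convex_hull (weyl_orbit lambda) mu.
Proof.
move=> l0; pose G nu (v : V) :=
  wspace nu v /\ (v = 0 \/ nu = lambda /\ exists a, v = a *: u).
have W1 := weyl_id D.
have ef0 i : uq_e i u = 0 /\ uq_f i u = 0.
  have E1 : pr i (\1%VF lambda) = 0 by rewrite lfunE.
  have [e0 _] := @uw_pos _ i 0 W1 E1.
  have [f0 _] := @uw_neg _ i 0 W1 (etrans E1 (esym (oppr0 _))).
  by rewrite uw1 in e0 f0.
move=> /(@is_weight_graded G lambda u gen); case.
- by move=> nu v [].
- move=> a nu v [Hv Hu]; split; first exact: wspaceZ.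
  case: Hu => [->|[-> [b ->]]]; first by left; rewrite scaler0.
  by right; split=> //; exists (a * b); rewrite scalerA.
- move=> i nu v [Hv Hu]; split; first exact: wspace_e.
  left; case: Hu => [->|[_ [b ->]]]; first exact: linear0.
  by rewrite linearZ /= (ef0 i).1 scaler0.
- move=> i nu v [Hv Hu]; split; first exact: wspace_f.
  left; case: Hu => [->|[_ [b ->]]]; first exact: linear0.
  by rewrite linearZ /= (ef0 i).2 scaler0.
- by split=> //; right; split=> //; exists 1; rewrite scale1r.
- move=> v v0 [_ [Ev|[-> _]]]; first by rewrite Ev eqxx in v0.
  exact/hull_base/orbit_self.
Qed.

Section LevelZero.
Hypothesis lambda0 : level lambda = 0.

Lemma reach_incl phi w w' mu v : W w -> maximal_at lambda (w phi) w ->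
  reach phi w w' -> up w mu v ->
  maximal_at lambda (w' phi) w' /\ up w' mu v.
Proof.
move=> Ww mx r Uv; elim: r => [|w2 i r [mx2 U2] pi]; first by [].
have W2 := reach_weyl r Ww; split.
  by rewrite comp_lfunE; apply: maximal_srefl.
exact: up_incl W2 (maximal_pr W2 mx2 pi) U2.
Qed.

(** Fix a recurrent point w0 of the walk guided by phi. The subspaces U^+ u_w,
    for w on the walk, grow; by fairness their sum is stable under every f_i,
    so it is V. A vector in one of them also lies in U^+ u_w for some later w
    with w phi = w0 phi modulo delta, where [demazure_bound] applies. *)
Lemma weight_bound (i0 : I) phi mu : level phi = 0 -> integral phi ->
  maximal_at lambda phi \1%VF -> is_weight mu ->
  form phi mu <= form phi lambda.
Proof.
move=> phi0 phi_int mx1 wmu.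
have [const|] := pselect (forall i, pr i phi = 0).
  have [r ->] := level0_radical i0 phi0 const.
  by rewrite !formZl -!/(level _) (is_weight_level wmu).
move=> /existsNP[j /eqP pj].
have phi_neq0 : exists i, pr i phi != 0 by exists j.
have W1 := weyl_id D.
have [w0 [W0 r0 rec]] := reach_recurrent phi0 phi_int W1.
have mx1' : maximal_at lambda (\1%VF phi) \1%VF by rewrite lfunE.
have [mx0 U0] := reach_incl W1 mx1' r0 (up_base _).
rewrite lfunE uw1 /= in U0.
pose G nu (v : V) := exists2 w, reach phi w0 w & up w nu v.
have key nu : is_weight nu -> form (w0 phi) nu <= form phi lambda.
  move=> wnu; have nu0 : level nu = 0 by rewrite (is_weight_level wnu).
  have [|||||v v0 [w r Uv]] := @is_weight_graded G lambda u gen _ _ _ _ _ nu wnu.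
  - by move=> ka v [w r]; apply: up_wspace; apply: reach_weyl r W0.
  - by move=> a ka v [w r Uv]; exists w => //; apply: up_Z.
  - by move=> i ka v [w r Uv]; exists w => //; apply: up_e.
  - move=> i ka v [w r Uv].
    have [mxw _] := reach_incl W0 mx0 r U0.
    have Ww := reach_weyl r W0.
    have [w' r' pi] := reach_fair phi0 phi_int phi_neq0 i Ww.
    have [mx' Uv'] := reach_incl Ww mxw r' Uv.
    have Ww' := reach_weyl r' Ww.
    exists (srefl i \o w')%VF; first exact: reach_step (reach_trans r r') pi.
    have pos := maximal_pr Ww' mx' pi.
    apply: up_f; first exact: weyl_refl.
      by rewrite comp_lfunE pr_srefl oppr_le0.
    exact: up_incl.
  - by exists w0; first exact: reach_refl.
  have [mxw _] := reach_incl W0 mx0 r U0.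
  have Ww := reach_weyl r W0.
  have [w2 r2 [s Es]] := rec _ r.
  have [mx2 Uv2] := reach_incl Ww mxw r2 Uv.
  have W2 := reach_weyl r2 Ww.
  have wt2 : up_weight w2 nu by exists v.
  have := demazure_bound i0 up_weight_above up_weight_incl up_weight_sym
    _ (integral_weyl W2 phi_int) W2 mx2 wt2.
  rewrite level_weyl // form_weyl // => /(_ phi0).
  by rewrite Es formDl formZl -/(level nu) nu0 mulr0 addr0.
by rewrite -(form_weyl phi mu W0); apply: key; apply: is_weight_weyl.
Qed.

(** A functional separating mu from the orbit, moved by the Weyl group so as to be
    maximal at lambda, contradicts [weight_bound] at a conjugate of mu. *)
Lemma zero_level_hull mu : is_weight mu -> convex_hull (weyl_orbit lambda) mu.
Proof.
move=> wmu; have [const|] := pselect (forall i, pr i lambda = 0).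
  exact: trivial_hull.
move=> /existsNP[i0 /eqP pi0].
have lambda_neq0 : exists i, pr i lambda != 0 by exists i0.
apply: contrapT => /(orbit_separation lambda0 (wlattice_integral lambdaP)
  lambda_neq0) [phi [phi0 phi_int [w [Ww mx lt]]]].
have [v Wv [vK Kv]] := weyl_inv Ww.
have E x y : form (v x) y = form x (w y) by rewrite -(form_weyl _ _ Ww) Kv.
have mx' : maximal_at lambda (v phi) \1%VF.
  by move=> w' Ww'; rewrite lfunE !E -comp_lfunE; apply: mx; apply: weyl_comp.
have := weight_bound i0 _ _ mx' (is_weight_weyl Wv wmu).
rewrite level_weyl // => /(_ phi0 (integral_weyl Wv phi_int)).
by rewrite !E Kv leNgt lt.
Qed.

End LevelZero.

End Extremal.

(** * Weights of the module and of the crystal *)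

Lemma weight_hull (D : affine_datum) (V : uqModule D)
    (lambda mu : dual (cartan D)) (u : V) :
  wlattice lambda -> extremal lambda u ->
  (forall S : set V, uq_submodule S -> S u -> forall v, S v) ->
  is_weight V mu -> convex_hull (weyl_orbit lambda) mu.
Proof.
move=> Pl ext gen wmu.
have [Hu [uw [uw1 uwP]]] := ext.
have level0 : level lambda != 0 -> exists i : idx D, true.
  apply: contraNP => noI; apply/eqP; rewrite level_sum big1 // => i _.
  by case: noI; exists i.
case: (ltrgt0P (level lambda)) => [pos|neg|zero].
- have [i0 _] := level0 (lt0r_neq0 pos).
  have [Hu' [uw' [uw1' uwP']]] := twist_extremal ext.
  have wmu' : is_weight (twist V) (- mu).
    by have [v v0 Hv] := wmu; exists v => //; apply: twist_wspace.
  have neg' : level (- lambda) < 0 by rewrite levelN oppr_lt0.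
  have hull := negative_level_hull (wlatticeN Pl) Hu' uw1' uwP'
    (twist_generated gen) i0 neg' wmu'.
  apply: hcone_hull; rewrite -[mu]opprK -scaleN1r.
  apply: (hcone_image (f := GRing.scale (-1 : rat)) _ (hull_hcone hull)).
  move=> _ [w Ww <-]; exists w => //.
  by rewrite linearN /= scaleN1r opprK.
- have [i0 _] := level0 (ltr0_neq0 neg).
  exact: (negative_level_hull Pl Hu uw1 uwP gen i0 neg wmu).
- exact: (zero_level_hull Pl Hu uw1 uwP gen zero wmu).
Qed.

(** A crystal element is nonzero modulo q_s L, so its weight is a weight of
    the module. *)
Lemma crystal_weight (D : affine_datum) (V : uqModule D) (L B : set V)
    (b : V) (mu : dual (cartan D)) :
  crystal_base L B -> B b -> has_weight L b mu -> is_weight V mu.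
Proof.
move=> cb Bb [x [Lx Hx bx]]; exists x => //.
apply/eqP => x0; rewrite x0 in bx.
have ratr1 : ratr 1 = 1 :> K by rewrite /ratr divr1.
suff : (1 : rat) = 0 by move/eqP; rewrite oner_eq0.
apply: (cb_free cb (s := [:: b]) (a := fun=> 1) _ isT _ _ (mem_head _ _)).
- by move=> y; rewrite inE => /eqP ->.
- by move=> y z; rewrite !inE => /eqP -> /eqP ->.
- by rewrite big_seq1 ratr1 scale1r.
Qed.

Theorem corollary5p2 (D : affine_datum) (lambda : dual (cartan D))
    (V : uqModule D) (u : V) (L B : set V) :
  wlattice lambda ->
  extremal_weight_module lambda u ->
  crystal_base L B ->
  forall (b : V) (mu : dual (cartan D)),
    B b -> has_weight L b mu -> convex_hull (weyl_orbit lambda) mu.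
Proof.
move=> Pl [ext gen _] cb b mu Bb wb.
exact: weight_hull Pl ext gen (crystal_weight cb Bb wb).
Qed.
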